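(* Let $G_1,G_2,\dots$ be a sequence of graphs such that $e(G_j)\to\infty$ as $j\to\infty$, and let $\mathcal W$ be a graphex. The following are equivalent: (1) The sequence is sampling convergent to $\mathcal W$, i.e. for all $r\in\mathbb R_+$, $\mathrm{SmplD}(G_j,r)\to\mathrm{GPD}(\mathcal W,r)$ weakly as $j\to\infty$. (2) The graphon process corresponding to the stretched canonical graphon converges to $\mathcal W$, in the sense that, for all $r\in\mathbb R_+$, $\mathrm{GPD}(W^{G_j,s},r)\to\mathrm{GPD}(\mathcal W,r)$ weakly as $j\to\infty$.
   Context: Graphs are finite, without multiple edges, but may have loops; $e(G)$ is the number of non-loop edges and $v(G)$ the number of vertices of $G$. An unlabeled graph is an isomorphism class of graphs; the set of finite unlabeled graphs is countable and discrete. Quantities depending on division by $e(G)$ are considered only when $e(G)\ge1$. $p$-sampling: $\mathsf{Smpl}(G,p)$ is the random unlabeled graph obtained by keeping each vertex of $G$ independently with probability $\min(p,1)$, taking the induced subgraph, discarding its isolated vertices (vertices contained in no edge, loop or non-loop), and forgetting labels. $\mathrm{SmplD}(G,r)$ is the probability distribution of $\mathsf{Smpl}(G,r/\sqrt{2e(G)})$. Stretched canonical graphon: the empirical graphon $W^G\colon[0,1]^2\to\{0,1\}$ is obtained by ordering the vertices of $G$, partitioning $[0,1]^2$ into a $v(G)\times v(G)$ grid of equal squares, and setting $W^G=1$ on square $(i,j)$ if $(i,j)$ is an edge of $G$ and $0$ otherwise. Then $W^{G,s}(x,y)=W^G(\|W^G\|_1^{1/2}x,\|W^G\|_1^{1/2}y)$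 if $x,y\in[0,\|W^G\|_1^{-1/2})$ and $W^{G,s}(x,y)=0$ otherwise. (The superscript $s$ is just notation for ``stretched''.) Graphex: a triple $\mathcal W=(I,S,W)$ with $I\ge0$, $S\colon\mathbb R_+\to\mathbb R_+$ measurable with $\min(S,1)$ integrable, and a graphon $W\colon\mathbb R_+^2\to[0,1]$, symmetric and measurable, such that with $\mu_W(x)=\int_{\mathbb R_+}W(x,y)\,dy$ and $\Lambda$ Lebesgue measure: $\Lambda\{\mu_W=\infty\}=0$ and $\Lambda\{\mu_W>1\}<\infty$; $\int W(x,y)1[\mu_W(x)\le1]1[\mu_W(y)\le1]\,dx\,dy<\infty$; $\int W(x,x)\,dx<\infty$. A graphon $W$ is identified with the graphex $(0,0,W)$. Graphex process: given $\mathcal W$, let $$\xi=\sum_{i,j}1[\zeta_{\{i,j\}}\le W(\vartheta_i,\vartheta_j)]\delta_{\theta_i,\theta_j}+\sum_{j,k}1[\chi_{jk}\le S(\vartheta_j)](\delta_{\theta_j,\sigma_{jk}}+\delta_{\sigma_{jk},\theta_j})+\sum_k1[\eta_k\le I](\delta_{\rho_k,\rho_k'}+\delta_{\rho_k',\rho_k}),$$ where $\zeta_{\{i,j\}}$ are i.i.d. uniform on $[0,1]$, $\{(\theta_j,\vartheta_j)\}_j$ and, for each $i\in\mathbb N$, $\{(\sigma_{ij},\chi_{ij})\}_j$ are unit rate Poisson processes on $\mathbb R_+^2$, $\{(\rho_j,\rho_j',\eta_j)\}_j$ is a unit rate Poisson process on $\mathbb R_+^3$, all independent. $\Gamma_r$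 is the (a.s. finite) graph whose edges $\{a,b\}$ correspond to the atoms $(a,b)$ of $\xi$ in $[0,r]^2$ and whose vertices are the labels occurring in at least one such edge. $\mathrm{GPD}(\mathcal W,r)$ is the distribution of the unlabeled graph obtained from $\Gamma_r$ by forgetting labels. *)

(* Defs.v *)
From HB Require Import structures.
From mathcomp Require Import all_boot all_order all_algebra finmap.
From mathcomp Require Import all_classical all_reals all_analysis measurable_realfun.

Set Implicit Arguments.
Unset Strict Implicit.
Unset Printing Implicit Defensive.

Import Order.TTheory GRing.Theory Num.Theory.
Import numFieldNormedType.Exports.

Local Open Scope classical_set_scope.
Local Open Scope ring_scope.

(* A finite graph together with an ordering of its vertices: the vertex set is
   {0, ..., vertex_count - 1}.  Loops are the vertices i with adj i i. *)
Record graph := Graph {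
  vertex_count : nat;
  adj : rel 'I_vertex_count;
  adjC : symmetric adj }.

HB.instance Definition _ := gen_eqMixin graph.
HB.instance Definition _ := gen_choiceMixin graph.

Definition edges (G : graph) : nat :=
  #|[set u : 'I_(vertex_count G) * 'I_(vertex_count G) | (u.1 < u.2)%N && adj u.1 u.2]|.

Definition isomorphic (G H : graph) : bool :=
  `[< exists2 f : 'I_(vertex_count G) -> 'I_(vertex_count H), bijective f &
      forall x y, adj (f x) (f y) = adj x y >].

Lemma isomorphic_refl : reflexive isomorphic.
Proof. by move=> G; apply/asboolP; exists id => //; exists id. Qed.

Lemma isomorphic_sym : symmetric isomorphic.
Proof.
suff iso_sym G H : isomorphic G H -> isomorphic H G.
  by move=> G H; apply/idP/idP; exact: iso_sym.
move=> /asboolP[f [g fK gK] fP]; apply/asboolP; exists g; first by exists f.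
by move=> x y; rewrite -fP !gK.
Qed.

Lemma isomorphic_trans : transitive isomorphic.
Proof.
move=> H G K /asboolP[f bf fP] /asboolP[g bg gP]; apply/asboolP.
by exists (g \o f); [exact: bij_comp | move=> x y /=; rewrite gP fP].
Qed.

Definition isomorphic_equiv : equiv_rel graph :=
  EquivRel isomorphic isomorphic_refl isomorphic_sym isomorphic_trans.

Definition ugraph : Type := {eq_quot isomorphic_equiv}%qT.

HB.instance Definition _ := Choice.on ugraph.

Definition unlabel (G : graph) : ugraph := (\pi_({eq_quot isomorphic_equiv}) G)%qT.

(* The graph with vertices the entries of s and adjacency relation e. *)
Definition seq_graph (T : Type) (s : seq T) (e : rel T) (eC : symmetric e) :
    graph :=
  @Graph (size s) (fun i j => e (tnth (in_tuple s) i) (tnth (in_tuple s) j))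
    (fun i j => eC _ _).

Definition empty_graph : graph := @Graph 0 (fun _ _ => false) (fun _ _ => erefl).

HB.instance Definition _ := isPointed.Build ugraph (unlabel empty_graph).
HB.instance Definition _ := hasNbhs.Build ugraph principal_filter.
HB.instance Definition _ := Discrete_ofNbhs.Build ugraph erefl.
HB.instance Definition _ := @isMeasurable.Build default_measure_display
  ugraph discrete_measurable discrete_measurable0
  discrete_measurableC discrete_measurableU.

Section weak_convergence.
Context {R : realType}.
Local Open Scope ereal_scope.

Definition weakly_converges (mu_ : nat -> set ugraph -> \bar R)
    (mu : set ugraph -> \bar R) : Prop :=
  forall f : ugraph -> R, continuous (f : ugraph -> R^o) -> bounded_fun f ->
    \int[mu_ n]_x (f x)%:E @[n --> \oo] --> \int[mu]_x (f x)%:E.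

End weak_convergence.

Section sampling.
Context {R : realType}.

(* The subgraph induced on A, with its isolated vertices discarded; a vertex
   whose only neighbour is itself is not isolated. *)
Definition induced_ugraph (G : graph) (A : {set 'I_(vertex_count G)}) : ugraph :=
  unlabel (seq_graph
    (enum [set v in A | [exists w, (w \in A) && adj v w]]) (@adjC G)).

(* The law of the p-sample: the set of kept vertices is A with probability
   q ^ #|A| * (1 - q) ^ #|~: A|, where q = min(p, 1). *)
Definition Smpl (G : graph) (p : R) (U : set ugraph) : \bar R :=
  let q := Num.min p 1 in
  (\sum_(A : {set 'I_(vertex_count G)})
    (\prod_(v < vertex_count G) (if v \in A then q else 1 - q))%:E
      * \d_(induced_ugraph A) U)%E.

Definition SmplD (G : graph) (r : R) : set ugraph -> \bar R :=
  Smpl G (r / Num.sqrt (2 * edges G)%:R).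

End sampling.

Section graphex.
Context {R : realType}.

Local Notation Lambda := (@lebesgue_measure R).
Local Notation Lambda2 := (Lambda \x Lambda)%E.
Local Notation RR := (measurableTypeR R).
Local Notation Rplus := (`[0%R, +oo[%classic : set R).

Record graphex := Graphex {
  isolated_rate : R;
  star_rate : R -> R;
  graphon : R -> R -> R }.

Definition graphon_deg (W : R -> R -> R) (x : R) : \bar R :=
  (\int[Lambda]_(y in Rplus) (W x y)%:E)%E.

(* Functions on R_+ are represented by functions on R, whose values at negative
   reals are irrelevant. *)
Record is_graphex (X : graphex) : Prop := {
  isolated_rate_ge0 : 0 <= isolated_rate X;
  star_rate_ge0 : forall x, 0 <= x -> 0 <= star_rate X x;
  star_rate_measurable : measurable_fun (Rplus : set RR) (star_rate X);
  star_rate_integrable :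
    Lambda.-integrable Rplus (fun x => (Num.min (star_rate X x) 1)%:E);
  graphon_ge0_le1 : forall x y, 0 <= x -> 0 <= y -> 0 <= graphon X x y <= 1;
  graphonC : forall x y, 0 <= x -> 0 <= y -> graphon X x y = graphon X y x;
  graphon_measurable :
    measurable_fun (Rplus `*` Rplus : set (RR * RR)) (fun z => graphon X z.1 z.2);
  graphon_deg_fin_num :
    Lambda (Rplus `&` [set x | graphon_deg (graphon X) x = +oo%E]) = 0%E;
  graphon_deg_gt1 :
    (Lambda (Rplus `&` [set x | (1 < graphon_deg (graphon X) x)%E]) < +oo)%E;
  graphon_deg_le1 :
    let B := Rplus `&` [set x | (graphon_deg (graphon X) x <= 1)%E] in
    (\int[Lambda2]_(z in B `*` B) (graphon X z.1 z.2)%:E < +oo)%E;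
  graphon_diag :
    (\int[Lambda]_(x in Rplus) (graphon X x x)%:E < +oo)%E }.

Definition graphex_of_graphon (W : R -> R -> R) : graphex :=
  Graphex 0 (fun=> 0) W.

(* With n vertices, square (i, j) is [i/n, (i+1)/n) x [j/n, (j+1)/n). *)
Definition empirical_graphon (G : graph) (x y : R) : R :=
  let in_cell (i : 'I_(vertex_count G)) (t : R) :=
    (i%:R / (vertex_count G)%:R <= t) && (t < i.+1%:R / (vertex_count G)%:R) in
  ([exists i, exists j, [&& in_cell i x, in_cell j y & adj i j]] : bool)%:R.

Definition empirical_norm1 (G : graph) : R :=
  \int[Lambda2]_(z in `[0, 1] `*` `[0, 1]) `|empirical_graphon G z.1 z.2|.

Definition stretched_graphon (G : graph) (x y : R) : R :=
  let s := Num.sqrt (empirical_norm1 G) in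
  if [&& 0 <= x < s^-1 & 0 <= y < s^-1]
  then empirical_graphon G (s * x) (s * y) else 0.

End graphex.

Section poisson_process.
Context {R : realType} {d : measure_display} {Omega : measurableType d}.
Variable P : probability Omega R.

Definition mutually_independent (I : choiceType) (D : set I)
    (F : I -> set (set Omega)) : Prop :=
  forall J : {fset I}, [set` J] `<=` D ->
  forall A : I -> set Omega, (forall i, i \in J -> F i (A i)) ->
  P (\bigcap_(i in [set` J]) A i) = (\prod_(i <- J) P (A i))%E.

Context {d' : measure_display} {E : measurableType d'}.

Definition sequence_sigma_algebra (X : nat -> Omega -> E) : set (set Omega) :=
  <<s \bigcup_j g_sigma_algebra_preimage (X j) >>.

Definition point_count (X : nat -> Omega -> E) (A : set E) (w : Omega) :
    \bar R :=
  counting [set j | A (X j w)].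

(* X enumerates the points of a Poisson process on D with intensity mu, given by
   its counts on sets of finite measure.  poisson_prob ignores its second
   argument; unlike poisson_pmf it is the Poisson law at rate 0 too. *)
Definition poisson_process (mu : {measure set E -> \bar R}) (D : set E)
    (X : nat -> {RV P >-> E}) : Prop :=
  [/\ forall j w, D (X j w),
      forall A, measurable A -> A `<=` D -> (mu A < +oo)%E -> forall k : nat,
        P [set w | point_count X A w = k%:R%:E] =
        poisson_prob (fine (mu A)) k [set k]
    & forall A : nat -> set E,
        (forall i, [/\ measurable (A i), A i `<=` D & (mu (A i) < +oo)%E]) ->
        trivIset setT A ->
        mutually_independent setT
          (fun i => g_sigma_algebra_preimage (point_count X (A i)))].

End poisson_process.

Variant source_index :=
  Vertices | Coin of nat & nat | Stars of nat | IsolatedEdges.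

HB.instance Definition _ := gen_eqMixin source_index.
HB.instance Definition _ := gen_choiceMixin source_index.

Section graphex_process.
Context {R : realType} {d : measure_display} {Omega : measurableType d}.
Variable P : probability Omega R.

Local Notation Lambda := (@lebesgue_measure R).
Local Notation RR := (measurableTypeR R).
Local Notation Rplus := (`[0%R, +oo[%classic : set R).

(* The sources of randomness of a graphex process:
     vertices j = (theta_j, vartheta_j),     coin i j = zeta_{i,j},
     stars j k = (sigma_jk, chi_jk),          isolated_edges k = (rho_k, rho'_k, eta_k).
   Independence is that of the enumerating sequences, not only of the point
   processes which they enumerate. *)
Record graphex_source := GraphexSource {
  vertices : nat -> {RV P >-> (RR * RR)%type};
  coin : nat -> nat -> {RV P >-> R};
  stars : nat -> nat -> {RV P >-> (RR * RR)%type};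
  isolated_edges : nat -> {RV P >-> (RR * RR * RR)%type};
  vertices_poisson :
    poisson_process (Lambda \x Lambda)%E (Rplus `*` Rplus) vertices;
  coinC : forall i j, coin i j = coin j i;
  coin_uniform : forall i j A, measurable A ->
    distribution P (coin i j) A = uniform_prob (@ltr01 R) A;
  stars_poisson : forall i,
    poisson_process (Lambda \x Lambda)%E (Rplus `*` Rplus) (stars i);
  isolated_edges_poisson :
    poisson_process ((Lambda \x Lambda) \x Lambda)%E
      (Rplus `*` Rplus `*` Rplus) isolated_edges;
  source_independent :
    mutually_independent P
      [set s | if s is Coin i j then (i <= j)%N else true]
      (fun s => match s with
        | Vertices => sequence_sigma_algebra vertices
        | Coin i j => g_sigma_algebra_preimage (coin i j)
        | Stars i => sequence_sigma_algebra (stars i)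
        | IsolatedEdges => sequence_sigma_algebra isolated_edges
        end) }.

Variables (X : graphex_source) (W : graphex (R := R)).

Local Notation theta j w := ((vertices X j w).1 : R).
Local Notation vtheta j w := ((vertices X j w).2 : R).
Local Notation sigma j k w := ((stars X j k w).1 : R).
Local Notation chi j k w := ((stars X j k w).2 : R).
Local Notation rho k w := ((isolated_edges X k w).1.1 : R).
Local Notation rho' k w := ((isolated_edges X k w).1.2 : R).
Local Notation eta k w := ((isolated_edges X k w).2 : R).

(* The random measure xi. *)
Definition graphex_process (w : Omega) (A : set (R * R)) : \bar R :=
  (\esum_(u in [set u : nat * nat |
        (coin X u.1 u.2 w <= graphon W (vtheta u.1 w) (vtheta u.2 w))%R])
      \d_(theta u.1 w, theta u.2 w) A
   + \esum_(u in [set u : nat * nat |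
        (chi u.1 u.2 w <= star_rate W (vtheta u.1 w))%R])
      (\d_(theta u.1 w, sigma u.1 u.2 w) A
       + \d_(sigma u.1 u.2 w, theta u.1 w) A)
   + \esum_(k in [set k | (eta k w <= isolated_rate W)%R])
      (\d_(rho k w, rho' k w) A + \d_(rho' k w, rho k w) A))%E.

(* {a, b} is an edge of Gamma_r. *)
Definition process_adj (r : R) (w : Omega) (a b : R) : bool :=
  [&& 0 <= a <= r, 0 <= b <= r &
      (0 < graphex_process w [set (a, b)])%E
      || (0 < graphex_process w [set (b, a)])%E].

Lemma process_adjC r w : symmetric (process_adj r w).
Proof. by move=> a b; rewrite /process_adj orbC andbCA. Qed.

Definition process_vertices (r : R) (w : Omega) : set R :=
  [set a | exists b, process_adj r w a b].

(* On the null event where Gamma_r is infinite, fset_set is empty, and the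
   value is the empty graph. *)
Definition process_ugraph (r : R) (w : Omega) : ugraph :=
  unlabel (seq_graph (fset_set (process_vertices r w)) (@process_adjC r w)).

Definition GPD (r : R) : set ugraph -> \bar R := pushforward P (process_ugraph r).

End graphex_process.

(* Main.v *)
(** Write [c = 1 / sqrt (2 e + l)], where [G] has [e] non-loop edges and [l]
    loops: in the stretched graphon every vertex [v] occupies a cell of length
    [c].  Let [H_t] be the set of vertices whose cell is hit by the Poisson
    process before time [t].  The cells are hit independently with probability
    [1 - exp (- t c)], so the graph induced on [H_t] is exactly a
    [(1 - exp (- t c))]-sample of [G]; for the time [t >= r] at which this
    probability equals [r / sqrt (2 e)] it has law [SmplD G r].  The graph
    induced on [H_t] and the graphon process at time [r] differ only if some
    visible vertex is hit twice before [r] or is hit between [r] and [t].  A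
    vertex is visible only if a neighbour is hit (or it is a loop), which
    provides the additional factor that makes this event have probability
    [O (1 / sqrt e)] as soon as [l = O (sqrt e)].

    Both (1) and (2) imply [l = O (sqrt e)]: test the convergence at [r = 1]
    against [2^(- number of loops)].  The limit is positive, whereas the
    expectation before the limit is at most [(1 - q / 2)^l], with [q] of order
    [1 / sqrt (2 e)], resp. [1 / sqrt (2 e + l)]. *)
Require Import Defs.
From HB Require Import structures.
From mathcomp Require Import all_boot all_order all_algebra finmap.
From mathcomp Require Import all_classical all_reals all_analysis measurable_realfun.
From mathcomp Require Import lra.

Set Implicit Arguments.
Unset Strict Implicit.
Unset Printing Implicit Defensive.

Import Order.TTheory GRing.Theory Num.Theory.
Import numFieldNormedType.Exports.

Local Open Scope classical_set_scope.
Local Open Scope ring_scope.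

(** * Unlabeled graphs *)

(** The obstacle is that the two sides are scaled differently: sampling by x = sqrt (2 e), the cells
    by y = sqrt (2 e + l). With l = O (x) the rates r / x and r / y differ by O (1 / x ^ 2), so a
    given vertex is hit twice before r, or hit between r and t, with probability O (1 / x ^ 2).
    Summing this over the vertices would not suffice, since the number of vertices that have an edge
    can be of order x ^ 2. The union bound runs over the arcs (u, v) instead: if u and v differ,
    requiring that v is hit too costs a further factor O (1 / x) by independence. A loop lacks this
    factor, but there are only l = O (x) loops. The total is of order x ^ 2 / x ^ 3 + x / x ^ 2,
    that is O (1 / x). The sampled graph is realised on the probability space of the given sources,
    as a function of the set of hit cells, so both laws are compared there. *)

Lemma unlabel_eqP (G H : graph) : unlabel G = unlabel H <-> isomorphic G H.
Proof.
rewrite /unlabel; split=> [/eqmodP//|iGH].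
by apply/eqmodP.
Qed.

(** Describes the isomorphism class by a map into the label type [T] itself, so that later arguments
    never handle positions in [s]. *)
Lemma unlabel_seq_graphP (T : eqType) (s : seq T) (e : rel T)
    (eC : symmetric e) (H : graph) : uniq s ->
  unlabel (seq_graph s eC) = unlabel H <->
  exists f : 'I_(vertex_count H) -> T,
    [/\ injective f, forall x, x \in s <-> exists i, f i = x
      & forall i j, e (f i) (f j) = adj i j].
Proof.
move=> us; split.
  move/esym/unlabel_eqP => /asboolP[f bf fP].
  exists (fun i => tnth (in_tuple s) (f i)); split.
  - by move=> i j /(tuple_uniqP (in_tuple s) us)/(bij_inj bf).
  - move=> x; split=> [xs|[i <-]]; last exact: mem_tnth.
    have /tnthP[k ->] : x \in in_tuple s by [].
    by case: bf => g _ gK; exists (g k); rewrite gK.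
  - by move=> i j; rewrite -fP.
move=> [f [injf fs fP]]; apply/esym/unlabel_eqP/asboolP.
have fi i : f i \in in_tuple s by apply/fs; exists i.
pose h i := sval (sig_eqW (tnthP _ _ (fi i))).
have hP i : f i = tnth (in_tuple s) (h i) by rewrite /h; case: sig_eqW.
exists h; last by move=> x y /=; rewrite -!hP fP.
have injh : injective h by move=> i j hij; apply: injf; rewrite !hP hij.
have hsurj k : exists i, h i = k.
  have /fs[i fik] : tnth (in_tuple s) k \in s by exact: mem_tnth.
  by exists i; apply: (tuple_uniqP (in_tuple s) us); rewrite -hP.
exists (fun k => sval (cid (hsurj k))).
  by move=> i; apply: injh; case: cid.
by move=> k; case: cid.
Qed.

(** Serves to compare a graph on real labels with one on the vertices of [G]: there [phi] sends a
    label to the vertex whose cell it marks. *)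
Lemma unlabel_seq_graph_eq (T T' : eqType) (s : seq T) (s' : seq T')
    (e : rel T) (e' : rel T') (eC : symmetric e) (eC' : symmetric e')
    (phi : T -> T') :
  uniq s -> uniq s' -> {in s &, injective phi} -> s' =i map phi s ->
  {in s &, forall x y, e' (phi x) (phi y) = e x y} ->
  unlabel (seq_graph s' eC') = unlabel (seq_graph s eC).
Proof.
move=> us us' iphi ss' ee'; apply/unlabel_seq_graphP => //=.
exists (fun i => phi (tnth (in_tuple s) i)); split.
- move=> i j /iphi; rewrite !mem_tnth => /(_ isT isT).
  exact: (tuple_uniqP (in_tuple s) us).
- move=> x; rewrite ss'; split=> [/mapP[y ys ->]|[i <-]].
    have /tnthP[k ->] : y \in in_tuple s by [].
    by exists k.
  by rewrite map_f//; exact: mem_tnth.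
- by move=> i j; rewrite ee'//; exact: mem_tnth.
Qed.

(** The chosen representative does not affect the count, by [loop_count_unlabel]. *)
Definition loop_count (g : ugraph) : nat :=
  let G := repr g in #|[pred v : 'I_(vertex_count G) | adj v v]|.

Lemma loop_count_unlabel (G : graph) :
  loop_count (unlabel G) = #|[pred v : 'I_(vertex_count G) | adj v v]|.
Proof.
rewrite /loop_count.
have /unlabel_eqP/asboolP[f bf fP] : unlabel (repr (unlabel G)) = unlabel G.
  by rewrite /unlabel reprK.
rewrite -(card_imset _ (bij_inj bf)); apply: eq_card => v.
apply/imsetP/idP => [[x xx ->]|vv]; first by rewrite inE fP.
by case: bf => g gK fK; exists (g v); rewrite ?fK// inE -fP fK.
Qed.

Lemma loop_count_seq_graph (T : eqType) (s : seq T) (e : rel T)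
    (eC : symmetric e) :
  loop_count (unlabel (seq_graph s eC)) = count (fun x => e x x) s.
Proof.
rewrite loop_count_unlabel /= -sum1_count (big_tnth _ _ s) /=.
by rewrite -sum1_card; apply: eq_bigl => i; rewrite inE.
Qed.

Lemma countable_ugraph : countable [set: ugraph].
Proof.
pose g (x : {n : nat & 'I_n * 'I_n -> bool}) : ugraph :=
  if pselect (symmetric (fun i j => projT2 x (i, j))) is left e
  then unlabel (Graph e) else unlabel empty_graph.
(* Finite functions form a countable type, so it suffices that they cover all unlabeled graphs; a
   relation that is not symmetric is sent to the empty graph. *)
pose h (x : {n : nat & {ffun 'I_n * 'I_n -> bool}}) : ugraph :=
  g (existT (fun n => 'I_n * 'I_n -> bool) (projT1 x) (projT2 x)).
have : [set: ugraph] `<=` h @` setT.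
  move=> u _; rewrite -[u]reprK; move: (repr u) => -[n e eC].
  exists (existT _ n [ffun x => e x.1 x.2]) => //.
  rewrite /h /g /=; case: pselect => [e'|[]]; last first.
    by move=> i j; rewrite !ffunE /= eC.
  apply/unlabel_eqP/asboolP; exists id; first by exists id.
  by move=> x y /=; rewrite ffunE.
move=> /subset_card_le /sub_countable; apply.
exact: sub_countable (card_image_le _ _) (countableP _).
Qed.

(** * Measurability of random graphs *)

Section measurable_predicates.
Context {d : measure_display} {T : measurableType d}.
Implicit Types P Q : T -> Prop.

Lemma measurable_exists (I : countType) (P : I -> T -> Prop) :
  (forall i, measurable [set w | P i w]) ->
  measurable [set w | exists i, P i w].
Proof.
move=> mP; rewrite [X in measurable X](_ : _ = \bigcup_i [set w | P i w]).
  by apply: countable_bigcupT_measurable => //; exact: countableP.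
by apply/seteqP; split=> w /= [i]; [exists i|move=> _ ?; exists i].
Qed.

Lemma measurable_not P : measurable [set w | P w] -> measurable [set w | ~ P w].
Proof. exact: measurableC. Qed.

Lemma measurable_forall (I : countType) (P : I -> T -> Prop) :
  (forall i, measurable [set w | P i w]) ->
  measurable [set w | forall i, P i w].
Proof.
move=> mP; rewrite [X in measurable X](_ : _ = [set w | ~ exists i, ~ P i w]).
  by apply/measurable_not/measurable_exists => i; exact: measurable_not.
apply/seteqP; split=> w /=; first by move=> h [i]; apply.
by move=> h i; apply: contrapT => nP; apply: h; exists i.
Qed.

Lemma measurable_imply P Q : measurable [set w | P w] ->
  measurable [set w | Q w] -> measurable [set w | P w -> Q w].
Proof.
move=> mP mQ.
rewrite [X in measurable X](_ : _ = (~` [set w | P w]) `|` [set w | Q w]).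
  by apply: measurableU => //; exact: measurableC.
apply/seteqP; split=> w /=; last by case.
by move=> PQ; have [/PQ|] := pselect (P w); [right|left].
Qed.

Lemma measurable_conj P Q : measurable [set w | P w] ->
  measurable [set w | Q w] -> measurable [set w | P w /\ Q w].
Proof. exact: measurableI. Qed.

Lemma measurable_disj P Q : measurable [set w | P w] ->
  measurable [set w | Q w] -> measurable [set w | P w \/ Q w].
Proof. exact: measurableU. Qed.

Lemma measurable_eq_funs (R : realType) (f g : T -> R) :
  measurable_fun setT f -> measurable_fun setT g ->
  measurable [set w | f w = g w].
Proof.
move=> mf mg; rewrite [X in measurable X](_ : _ =
    setT `&` (fun w => f w == g w) @^-1` [set true]).
  by apply: (measurable_fun_eqr mf mg).
by rewrite setTI; apply/seteqP; split=> w /= /eqP.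
Qed.

Lemma measurable_le_funs (R : realType) (f g : T -> R) :
  measurable_fun setT f -> measurable_fun setT g ->
  measurable [set w | f w <= g w].
Proof.
move=> mf mg; rewrite [X in measurable X](_ : _ =
    setT `&` (fun w => f w <= g w) @^-1` [set true]).
  by apply: (measurable_fun_ler mf mg).
by rewrite setTI.
Qed.

Lemma measurable_cst_prop (P : Prop) : measurable [set w : T | P].
Proof.
have [p|np] := pselect P.
  by rewrite [X in measurable X](_ : _ = setT)//; apply/seteqP; split.
by rewrite [X in measurable X](_ : _ = set0)//; apply/seteqP; split.
Qed.

Lemma measurable_eqb (P : T -> bool) (b : bool) :
  measurable [set w | P w] -> measurable [set w | P w = b].
Proof.
case: b => // mP.
rewrite [X in measurable X](_ : _ = [set w | ~ P w]); first exact: measurable_not.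
by apply/seteqP; split=> w /= /negP; case: (P w).
Qed.

(** Unlabeled graphs are countably many, so every set of them is a countable union of singletons. *)
Lemma measurable_fun_ugraph (h : T -> ugraph) :
  (forall H, measurable [set w | h w = unlabel H]) -> measurable_fun setT h.
Proof.
move=> mh _ B _; rewrite setTI.
rewrite [X in measurable X](_ : _ =
    \bigcup_g [set w | h w = g /\ B g]); last first.
  apply/seteqP; split=> [w Bw|w [g _] [/= ->]//].
  by exists (h w).
apply: countable_bigcupT_measurable => [|g]; first exact: countable_ugraph.
apply: measurable_conj; last exact: measurable_cst_prop.
by have := mh (repr g); rewrite /unlabel reprK.
Qed.

End measurable_predicates.

Lemma fset_set_infinite (T : choiceType) (A : set T) :
  ~ finite_set A -> fset_set A = fset0.
Proof. by rewrite /fset_set; case: pselect. Qed.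

(** * Graphs on countably many random labels *)

Section measurable_random_graph.
Context {d : measure_display} {T : measurableType d} {R : realType}.
Context {I : countType}.
Variables (a : I -> T -> R) (Q : I -> I -> T -> Prop).
Variables (e : T -> rel R) (eC : forall w, symmetric (e w)).
Hypothesis ma : forall i, measurable_fun setT (a i).
Hypothesis mQ : forall i j, measurable [set w | Q i j w].
Hypothesis eE : forall w x y,
  e w x y <-> exists i j, [/\ Q i j w, x = a i w & y = a j w].

Let V w : set R := [set x | exists y, e w x y].

Let VE w x : V w x -> exists i, x = a i w.
Proof. by move=> [y /eE[i [j [_ -> _]]]]; exists i. Qed.

(** Several indices may carry the same label, so an edge between two labels may come from indices
    other than the given ones. *)
Let m_e i j : measurable [set w | e w (a i w) (a j w)].
Proof.
rewrite [X in measurable X](_ : _ =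
    [set w | exists i', exists j', Q i' j' w /\ (a i w = a i' w /\ a j w = a j' w)]).
  apply: measurable_exists => i'; apply: measurable_exists => j'.
  apply: measurable_conj => //.
  by apply: measurable_conj; apply: measurable_eq_funs.
apply/seteqP; split=> w /=; first by move=> /eE[i' [j' [? ? ?]]]; exists i', j'.
by move=> [i' [j' [? [? ?]]]]; apply/eE; exists i', j'.
Qed.

Let m_V i : measurable [set w | V w (a i w)].
Proof.
rewrite [X in measurable X](_ : _ = [set w | exists j, e w (a i w) (a j w)]).
  exact: measurable_exists.
apply/seteqP; split=> w /=; last by move=> [j ?]; exists (a j w).
by move=> [y ey]; have /eE[_ [j [_ _ yE]]] := ey; exists j; rewrite -yE.
Qed.

(** Expresses finiteness of the vertex set with quantifiers over countable types only, which keeps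
    it measurable. *)
Let covers n (k : {ffun 'I_n -> I}) w :=
  forall i, V w (a i w) -> exists x, a i w = a (k x) w.

Let m_covers n (k : {ffun 'I_n -> I}) : measurable [set w | covers k w].
Proof.
apply: measurable_forall => i; apply: measurable_imply => //.
by apply: measurable_exists => x; exact: measurable_eq_funs.
Qed.

Let finite_VP w : finite_set (V w) <->
  exists n (k : {ffun 'I_n -> I}), covers k w.
Proof.
split=> [fV|[n [k kw]]].
  pose s := enum_fset (fset_set (V w)).
  have sV x : x \in s = (x \in V w) by rewrite in_fset_set.
  have idx (j : 'I_(size s)) : exists i, tnth (in_tuple s) j = a i w.
    by apply: VE; have := mem_tnth j (in_tuple s); rewrite sV inE.
  exists (size s), [ffun j => sval (cid (idx j))] => i Vi.
  have : a i w \in s by rewrite sV inE.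
  move=> /(tnthP (in_tuple s))[j ->].
  by exists j; rewrite ffunE; case: cid.
apply: (@sub_finite_set _ _ [set` [seq a (k x) w | x : 'I_n]]).
  move=> x Vx; have [i xE] := VE Vx; move: Vx; rewrite xE => /kw[y ->] /=.
  by apply/mapP; exists y => //; rewrite mem_enum.
exact: finite_seq.
Qed.

Let m_finite : measurable [set w | finite_set (V w)].
Proof.
rewrite [X in measurable X](_ : _ =
    [set w | exists n, exists k : {ffun 'I_n -> I}, covers k w]).
  by apply: measurable_exists => n; exact: measurable_exists.
by apply/seteqP; split=> w /= /finite_VP.
Qed.

Let embeds (H : graph) (k : {ffun 'I_(vertex_count H) -> I}) w :=
  (forall x y, a (k x) w = a (k y) w -> x = y) /\
  ((forall x, V w (a (k x) w)) /\
  (forall x y, e w (a (k x) w) (a (k y) w) = adj x y)).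

Let m_embeds (H : graph) (k : {ffun 'I_(vertex_count H) -> I}) :
  measurable [set w | embeds k w].
Proof.
apply: measurable_conj; last apply: measurable_conj.
- apply: measurable_forall => x; apply: measurable_forall => y.
  apply: measurable_imply; last exact: measurable_cst_prop.
  exact: measurable_eq_funs.
- exact: measurable_forall.
- apply: measurable_forall => x; apply: measurable_forall => y.
  exact: measurable_eqb.
Qed.

(** The graph is isomorphic to [H] when some finite family of indices lists all its vertices and
    reproduces the adjacency of [H]; there are countably many such families. If the vertex set is
    infinite, [fset_set] returns the empty set, which accounts for the alternative where [H] has no
    vertex. *)
Lemma measurable_seq_graph :
  measurable_fun setT (fun w =>
    unlabel (seq_graph (fset_set [set x | exists y, e w x y]) (eC w))).
Proof.
apply: measurable_fun_ugraph => H.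
rewrite [X in measurable X](_ : _ =
  [set w | (finite_set (V w) /\
      exists k : {ffun 'I_(vertex_count H) -> I}, covers k w /\ embeds k w) \/
    (~ finite_set (V w) /\ vertex_count H = 0%N)]).
  apply: measurable_disj; apply: measurable_conj => //.
  - apply: measurable_exists => k; exact: measurable_conj.
  - exact: measurable_not.
  - exact: measurable_cst_prop.
apply/seteqP; split=> w /=.
- move/unlabel_seq_graphP => /(_ (fset_uniq _))[f [finj fV fe]].
  have [fin|infin] := pselect (finite_set (V w)); last first.
    right; split=> //; case: (vertex_count H) f {finj fe} fV => // n f fV.
    by have /fV : exists i, f i = f ord0 by [exists ord0]; rewrite fset_set_infinite.
  left; split=> //.
  have Vf x : V w (f x).
    have /fV : exists i, f i = f x by exists x.
    by rewrite in_fset_set// inE.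
  have idx x : exists i, f x = a i w by exact: VE.
  exists [ffun x => sval (cid (idx x))].
  have kE x : a ([ffun x => sval (cid (idx x))] x) w = f x.
    by rewrite ffunE; case: cid.
  split.
    move=> i Vi; have : a i w \in fset_set (V w) by rewrite in_fset_set// inE.
    by move=> /fV[x <-]; exists x; rewrite kE.
  split=> [x y|]; first by rewrite !kE => /finj.
  by split=> [x|x y]; rewrite !kE.
- move=> [[fin [k [kc [kinj [kV ke]]]]]|[infin H0]].
    apply/unlabel_seq_graphP; first exact: fset_uniq.
    exists (fun x => a (k x) w); split=> // x.
    rewrite in_fset_set// inE; split=> [Vx|[i <-]]; last exact: kV.
    have [i xE] := VE Vx; move: Vx; rewrite xE => /kc[y ->].
    by exists y.
  apply/unlabel_seq_graphP; first exact: fset_uniq.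
  exists (fun=> 0); split.
  + by move=> x; have := ltn_ord x; rewrite {2}H0.
  + move=> x; rewrite fset_set_infinite// inE; split=> // -[i].
    by have := ltn_ord i; rewrite {2}H0.
  + by move=> x; have := ltn_ord x; rewrite {2}H0.
Qed.

End measurable_random_graph.

(** * Atoms of the graphex process and measurability of its graphs *)

Section process_adjacency.
Context {R : realType} {d : measure_display} {Omega : measurableType d}.
Variable P : probability Omega R.
Local Notation RR := (measurableTypeR R).
Local Notation Rplus := (`[0%R, +oo[%classic : set R).

Lemma esum_gt0 (T : choiceType) (S : set T) (a : T -> \bar R) :
  (forall i, 0 <= a i)%E ->
  (0 < \esum_(i in S) a i)%E <-> exists2 i, S i & (0 < a i)%E.
Proof.
move=> a0; split=> [|[i Si ai]]; last first.
  apply: lt_le_trans ai _; apply: esum_ge; exists [set i].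
    by split=> // j ->.
  by rewrite fsbig_set1.
apply: contraPP => na; rewrite esum1 ?ltxx// => i Si; apply: contrapT => ai.
by apply: na; exists i; rewrite // lt_neqAle a0 andbT eq_sym; exact/eqP.
Qed.

Lemma dirac_set1_gt0 (d' : measure_display) (T : sigmaRingType d') (x y : T) :
  (0 < (\d_x [set y] : \bar R))%E <-> x = y.
Proof.
rewrite diracE; split=> [|->]; last by rewrite mem_set// lte_fin ltr01.
by case: (boolP (x \in _)) => [/set_mem//|_]; rewrite ltxx.
Qed.

Lemma adde_gt0P (x y : \bar R) : (0 <= x)%E -> (0 <= y)%E ->
  (0 < x + y)%E <-> (0 < x)%E \/ (0 < y)%E.
Proof.
move=> x0 y0; split=> [|[?|?]]; last 2 first.
- exact: lte_paddr.
- by rewrite addeC; exact: lte_paddr.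
rewrite !lt0e !adde_ge0// x0 y0 !andbT => /eqP xy.
have [x00|] := eqVneq x 0%E; last by left.
by right; apply/eqP => y00; apply: xy; rewrite x00 y00 adde0.
Qed.

Variables (X : graphex_source P) (W : graphex (R := R)).

Let theta j w : R := (vertices X j w).1.
Let vtheta j w : R := (vertices X j w).2.
Let sigma j k w : R := (stars X j k w).1.
Let chi j k w : R := (stars X j k w).2.
Let rho k w : R := (isolated_edges X k w).1.1.
Let rho' k w : R := (isolated_edges X k w).1.2.
Let eta k w : R := (isolated_edges X k w).2.

(** Positivity of the mass of a point, unfolded: only countable quantifiers and comparisons of
    measurable functions remain. *)
Definition process_atom (w : Omega) (a b : R) : Prop :=
  (exists i j, [/\ coin X i j w <= graphon W (vtheta i w) (vtheta j w),
     theta i w = a & theta j w = b]) \/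
  (exists j k, chi j k w <= star_rate W (vtheta j w) /\
     ((theta j w = a /\ sigma j k w = b) \/
      (sigma j k w = a /\ theta j w = b))) \/
  (exists k, eta k w <= isolated_rate W /\
     ((rho k w = a /\ rho' k w = b) \/ (rho' k w = a /\ rho k w = b))).

Lemma graphex_process_gt0 w a b :
  (0 < graphex_process X W w [set (a, b)])%E <-> process_atom w a b.
Proof.
have d0 z : (0 <= (\d_z [set (a, b)] : \bar R))%E by rewrite measure_ge0.
have dd0 z z' : (0 <= (\d_z [set (a, b)] + \d_z' [set (a, b)] : \bar R))%E.
  exact: adde_ge0.
rewrite /graphex_process adde_gt0P; last 2 first.
- by apply: adde_ge0; apply: esum_ge0 => ? _.
- by apply: esum_ge0.
rewrite adde_gt0P; last 2 first.
- by apply: esum_ge0 => ? _.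
- by apply: esum_ge0.
rewrite !esum_gt0// /process_atom.
have pairE (x y : R) : (x, y) = (a, b) <-> x = a /\ y = b.
  by split=> [[-> ->]|[-> ->]].
split=> [[[[[i j] /= h]|[[j k] /= h]]|[k /= h]]|].
- by move=> /dirac_set1_gt0[<- <-]; left; exists i, j.
- rewrite adde_gt0P// !dirac_set1_gt0 !pairE => hh.
  by right; left; exists j, k.
- rewrite adde_gt0P// !dirac_set1_gt0 !pairE => hh.
  by right; right; exists k.
move=> [[i [j [h ta tb]]]|[[j [k [h hh]]]|[k [h hh]]]].
- by left; left; exists (i, j) => //=; apply/dirac_set1_gt0/pairE.
- left; right; exists (j, k) => //=.
  by rewrite adde_gt0P// !dirac_set1_gt0 !pairE.
- right; exists k => //=.
  by rewrite adde_gt0P// !dirac_set1_gt0 !pairE.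
Qed.

Lemma process_adjP r w a b : process_adj X W r w a b <->
  [/\ 0 <= a <= r, 0 <= b <= r & process_atom w a b \/ process_atom w b a].
Proof.
split=> [/and3P[-> -> /orP ab]|[ha hb ab]].
  by split=> //; move: ab; rewrite !graphex_process_gt0.
by apply/and3P; split=> //; apply/orP; rewrite !graphex_process_gt0.
Qed.

Let m_pair (h : {RV P >-> (RR * RR)%type}) :
  measurable_fun setT (fun w => (h w).1) /\ measurable_fun setT (fun w => (h w).2).
Proof. by apply/measurable_fun_pairP; exact: measurable_funP. Qed.

Let m_theta j : measurable_fun setT (theta j).
Proof. exact: (m_pair _).1. Qed.
Let m_vtheta j : measurable_fun setT (vtheta j).
Proof. exact: (m_pair _).2. Qed.
Let m_sigma j k : measurable_fun setT (sigma j k).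
Proof. exact: (m_pair _).1. Qed.
Let m_chi j k : measurable_fun setT (chi j k).
Proof. exact: (m_pair _).2. Qed.

Let m_triple (h : {RV P >-> (RR * RR * RR)%type}) :
  [/\ measurable_fun setT (fun w => (h w).1.1),
      measurable_fun setT (fun w => (h w).1.2)
    & measurable_fun setT (fun w => (h w).2)].
Proof.
have /measurable_fun_pairP[/measurable_fun_pairP[]] : measurable_fun setT h.
  exact: measurable_funP.
by [].
Qed.

Let m_rho k : measurable_fun setT (rho k).
Proof. by case: (m_triple (isolated_edges X k)). Qed.
Let m_rho' k : measurable_fun setT (rho' k).
Proof. by case: (m_triple (isolated_edges X k)). Qed.
Let m_eta k : measurable_fun setT (eta k).
Proof. by case: (m_triple (isolated_edges X k)). Qed.

Lemma vertices_ge0 j w : 0 <= (vertices X j w).1 /\ 0 <= (vertices X j w).2.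
Proof.
by have [/(_ j w)[/= + +] _ _] := vertices_poisson X; rewrite !in_itv/= !andbT.
Qed.

Hypothesis mS : measurable_fun (Rplus : set RR) (star_rate W).
Hypothesis mW : measurable_fun (Rplus `*` Rplus : set (RR * RR))
  (fun z => graphon W z.1 z.2).

Let m_star j : measurable_fun setT (fun w => star_rate W (vtheta j w)).
Proof.
apply: (measurable_comp (F := Rplus : set RR)) => //=.
- by move=> _ [w _ <-]; rewrite /= in_itv/= andbT; case: (vertices_ge0 j w).
- exact: m_vtheta.
Qed.

Let m_graphon i j :
  measurable_fun setT (fun w => graphon W (vtheta i w) (vtheta j w)).
Proof.
apply: (measurable_comp (F := Rplus `*` Rplus : set (RR * RR))
  (f := fun z => graphon W z.1 z.2) (g := fun w => (vtheta i w, vtheta j w))) => //=.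
- by apply: measurableX; exact: measurable_itv.
- move=> _ [w _ <-]; rewrite /= !in_itv/= !andbT.
  by split; [case: (vertices_ge0 i w)|case: (vertices_ge0 j w)].
- apply: measurable_fun_pair; exact: m_vtheta.
Qed.

(** One countable index type for all labels of the process: the vertices, the leaves of the stars,
    and the isolated edges, where the boolean tells the two ends apart. *)
Let index : Type := nat + (nat * nat + nat * bool).

Let label (l : index) w : R := match l with
  | inl j => theta j w
  | inr (inl (j, k)) => sigma j k w
  | inr (inr (k, b)) => if b then rho k w else rho' k w
  end.

Let joined (l l' : index) w : Prop := match l, l' with
  | inl i, inl j => coin X i j w <= graphon W (vtheta i w) (vtheta j w)
  | inl i, inr (inl (j, k)) | inr (inl (j, k)), inl i =>
      i = j /\ chi j k w <= star_rate W (vtheta j w)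
  | inr (inr (k, b)), inr (inr (k', b')) =>
      (k = k' /\ b != b') /\ eta k w <= isolated_rate W
  | _, _ => False
  end.

Let m_joined l l' : measurable [set w | joined l l' w].
Proof.
case: l => [i|[[i k]|[i k]]]; case: l' => [i'|[[i' k']|[i' k']]] /=;
  try by exact: measurable_cst_prop.
- exact: measurable_le_funs.
- apply: measurable_conj; first exact: measurable_cst_prop.
  exact: measurable_le_funs.
- apply: measurable_conj; first exact: measurable_cst_prop.
  exact: measurable_le_funs.
- apply: measurable_conj; first exact: measurable_cst_prop.
  exact: measurable_le_funs.
Qed.

Let atomE w a b : process_atom w a b <->
  exists l l', [/\ joined l l' w, a = label l w & b = label l' w].
Proof.
split.
  move=> [[i [j [h <- <-]]]|[[j [k [h hh]]]|[k [h hh]]]].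
  - by exists (inl i), (inl j).
  - case: hh => -[<- <-]; first by exists (inl j), (inr (inl (j, k))).
    by exists (inr (inl (j, k))), (inl j).
  - case: hh => -[<- <-].
      by exists (inr (inr (k, true))), (inr (inr (k, false))).
    by exists (inr (inr (k, false))), (inr (inr (k, true))).
move=> [l [l' [+ -> ->]]].
case: l => [i|[[i k]|[i k]]]; case: l' => [i'|[[i' k']|[i' k']]] //=.
- by left; exists i, i'.
- by move=> [-> h]; right; left; exists i', k'; split => //; left.
- by move=> [-> h]; right; left; exists i, k; split => //; right.
- move=> [[-> kk'] h]; right; right; exists i'; split=> //.
  by case: k k' kk' => -[]// _; [left|right].
Qed.

(** This is what allows integrals against the pushforward [GPD] to be computed on [Omega]. *)
Lemma measurable_process_ugraph r : measurable_fun setT (process_ugraph X W r).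
Proof.
have m_label l : measurable_fun setT (label l).
  case: l => [j|[[j k]|[k []]]] /=.
  - exact: m_theta.
  - exact: m_sigma.
  - exact: m_rho.
  - exact: m_rho'.
have m_range l : measurable [set w | 0 <= label l w <= r].
  rewrite [X in measurable X](_ : _ =
      [set w | 0 <= label l w /\ label l w <= r]).
    by apply: measurable_conj; apply: measurable_le_funs.
  by apply/seteqP; split=> w /= => [/andP[]|[-> ->]].
apply: (@measurable_seq_graph _ _ _ _ label
  (fun l l' w => 0 <= label l w <= r /\ (0 <= label l' w <= r /\
     (joined l l' w \/ joined l' l w)))) => //.
  move=> l l'; apply: measurable_conj => //; apply: measurable_conj => //.
  exact: measurable_disj.
move=> w x y; rewrite process_adjP; split.
  move=> [xr yr [/atomE|/atomE]] [l [l' [ll' xE yE]]].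
    by exists l, l'; split=> //; rewrite -xE -yE; split=> //; split=> //; left.
  by exists l', l; split=> //; rewrite -xE -yE; split=> //; split=> //; right.
move=> [l [l' [[lr [l'r ll']] -> ->]]]; split=> //.
by case: ll' => ?; [left|right]; apply/atomE; [exists l, l'|exists l', l].
Qed.

End process_adjacency.

(** * Points of a Poisson process *)

Section counting_nat.
Context {R : realType}.
Implicit Type S : set nat.

Lemma counting_eq0 S : counting S = 0%E :> \bar R <-> ~ exists j, S j.
Proof.
rewrite /counting; case: ifPn => /asboolP fS; last first.
  split=> // nS; exfalso; apply: fS; rewrite (_ : S = set0)//.
  by apply/seteqP; split=> // j Sj; apply: nS; exists j.
split=> [[/eqP]|nS].
  rewrite pnatr_eq0 cardfs_eq0 => /eqP S0 [j Sj].
  have : j \in fset_set S by rewrite in_fset_set// inE.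
  by rewrite S0 inE.
rewrite (_ : S = set0) ?fset_set0//.
by apply/seteqP; split=> // j Sj; apply: nS; exists j.
Qed.

Lemma counting_gt1 S : (1%:E < counting S :> \bar R)%E <->
  exists i j, i != j /\ (S i /\ S j).
Proof.
rewrite /counting; case: ifPn => /asboolP fS; last first.
  split=> [_|]; last by rewrite ltry.
  apply: contrapT => nS; apply: fS.
  have [[i Si]|nSi] := pselect (exists i, S i); last first.
    rewrite (_ : S = set0)//; apply/seteqP; split=> // j Sj.
    by apply: nSi; exists j.
  apply: (@sub_finite_set _ _ [set i]) => // j Sj /=.
  by apply/eqP/negPn/negP => ji; apply: nS; exists j, i.
rewrite lte_fin ltr1n; split=> [|[i [j [ij [Si Sj]]]]].
  move: (fset_uniq (fset_set S)); move sE : (enum_fset (fset_set S)) => s us.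
  have sS x : x \in s -> S x.
    by rewrite -sE => xs; have : x \in fset_set S := xs; rewrite in_fset_set// inE.
  case: s {sE} us sS => [//|x [//|y s]] /= /andP[+ _] sS _.
  rewrite inE negb_or => /andP[xy _]; exists x, y; split=> //.
  by split; apply: sS; rewrite !inE eqxx ?orbT.
have : ([fset i; j] `<=` fset_set S)%fset.
  by apply/fsubsetP => x; rewrite !inE in_fset_set// inE => /orP[]/eqP ->.
by move/fsubset_leq_card; rewrite cardfs2 ij.
Qed.

Lemma counting_finite S k : counting S = k%:R%:E :> \bar R -> finite_set S.
Proof. by rewrite /counting; case: ifPn => // /asboolP. Qed.

End counting_nat.

Section poisson_points.
Context {R : realType} {d : measure_display} {Omega : measurableType d}.
Context {P : probability Omega R} {d' : measure_display} {E : measurableType d'}.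
Variables (mu : {measure set E -> \bar R}) (D : set E).
Variable (X : nat -> {RV P >-> E}).
Hypothesis XP : poisson_process mu D X.

Definition hit (A : set E) (w : Omega) : Prop := exists j, A (X j w).

Definition hit_twice (A : set E) (w : Omega) : Prop :=
  exists i j, i != j /\ (A (X i w) /\ A (X j w)).

Definition bounded_region (A : set E) :=
  [/\ measurable A, A `<=` D & (mu A < +oo)%E].

Let count A : Omega -> \bar R := point_count X A.

(** The law and the independence of a Poisson process are given for its counts, so hits are turned
    into events of counts. *)
Lemma hitE A : [set w | hit A w] = ~` (count A @^-1` [set 0%E]).
Proof.
apply/seteqP; split=> w /=; rewrite /count /point_count counting_eq0.
  by move=> hw; apply.
by move/contrapT.
Qed.

Lemma nhitE A : [set w | ~ hit A w] = count A @^-1` [set 0%E].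
Proof. by rewrite -[RHS]setCK -hitE. Qed.

Lemma hit_twiceE A : [set w | hit_twice A w] = count A @^-1` [set x | (1%:E < x)%E].
Proof. by apply/seteqP; split=> w /= /counting_gt1. Qed.

Lemma measurable_point j A : measurable A -> measurable [set w | A (X j w)].
Proof. by move=> mA; rewrite -[X in measurable X]setTI; exact: measurable_funP. Qed.

Lemma measurable_hit A : measurable A -> measurable [set w | hit A w].
Proof. by move=> mA; apply: measurable_exists => j; exact: measurable_point. Qed.

Lemma measurable_hit_twice A : measurable A -> measurable [set w | hit_twice A w].
Proof.
move=> mA; apply: measurable_exists => i; apply: measurable_exists => j.
apply: measurable_conj; first exact: measurable_cst_prop.
by apply: measurable_conj; exact: measurable_point.
Qed.

Lemma measurable_count A : measurable A -> measurable_fun setT (count A).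
Proof.
move=> mA; rewrite (_ : count A =
    fun w => (\sum_(n <oo) \d_n [set j | A (X j w)])%E); last first.
  by apply/funext => w; rewrite /count /point_count counting_dirac.
apply: ge0_emeasurable_sum => [k w _ _|k _]; first exact: measure_ge0.
rewrite (_ : (fun w => _) = (fun w => (\1_[set w | A (X k w)] w)%:E)).
  by apply/measurable_EFinP/measurable_indic/measurable_point.
apply/funext => w; rewrite diracE indicE; congr (_%:R%:E).
Qed.

Let rate A : R := fine (mu A).

Let rate_ge0 A : 0 <= rate A.
Proof. by rewrite fine_ge0. Qed.

Lemma prob_nhit A : bounded_region A ->
  P [set w | ~ hit A w] = (expR (- rate A))%:E.
Proof.
move=> [mA AD Afin]; have [_ /(_ A mA AD Afin 0%N) + _] := XP.
rewrite nhitE => ->; rewrite /poisson_prob -/(rate A).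
(* At rate 0, [poisson_prob] is a Dirac mass instead of a sum of [poisson_pmf], hence a separate
   case. *)
case: ifPn => [rA|]; first rewrite esum_set1 /poisson_pmf.
- by rewrite rA expr0 fact0 invr1 !mul1r.
- by rewrite lee_fin poisson_pmf_ge0.
rewrite -leNgt => rA; have -> : rate A = 0 by apply/le_anti; rewrite rA rate_ge0.
by rewrite oppr0 expR0 diracE mem_set.
Qed.

Lemma prob_hit A : bounded_region A ->
  P [set w | hit A w] = (1 - expR (- rate A))%:E.
Proof.
move=> bA; have mA : measurable A by case: bA.
rewrite (_ : [set w | hit A w] = ~` [set w | ~ hit A w]).
  rewrite probability_setC ?prob_nhit//.
  by apply: measurable_not; exact: measurable_hit.
by apply/seteqP; split=> w /= => [? //|/contrapT].
Qed.

Lemma prob_hit_le A : bounded_region A ->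
  (P [set w | hit A w] <= (rate A)%:E)%E.
Proof.
move=> bA; rewrite prob_hit// lee_fin.
by rewrite lerBlDr addrC -lerBlDr; have := expR_ge1Dx (- rate A).
Qed.

(** With rate a, the probability is 1 - (1 + a) exp (- a), and exp (- a) >= 1 - a bounds it by 1 -
    (1 + a) (1 - a) = a ^ 2. *)
Lemma prob_hit_twice_le A : bounded_region A ->
  (P [set w | hit_twice A w] <= (rate A ^+ 2)%:E)%E.
Proof.
move=> bA; have [mA AD Afin] := bA.
have [_ /(_ A mA AD Afin 1%N) one _] := XP.
have m1 : measurable (count A @^-1` [set 1%E]).
  by rewrite -[X in measurable X]setTI; exact: measurable_count.
have m0 : measurable (count A @^-1` [set 0%E]).
  by rewrite -[X in measurable X]setTI; exact: measurable_count.
have -> : [set w | hit_twice A w] =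
    ~` (count A @^-1` [set 0%E] `|` count A @^-1` [set 1%E]).
  rewrite hit_twiceE; apply/seteqP; split=> w /=.
    by move=> c1; case=> c; move: c1; rewrite c lte_fin ?ltxx ?ltr10.
  rewrite /count /point_count /counting; case: ifPn => _; last by rewrite ltry.
  case: #|` _| => [|[|n]] h; [exfalso; apply: h; by left|exfalso; apply: h; by right|].
  by rewrite lte_fin ltr1n.
rewrite probability_setC; last exact: measurableU.
rewrite measureU//; last first.
  by apply/seteqP; split=> // w [/= -> /eqP]; rewrite eqe eq_sym oner_eq0.
have zero := prob_nhit bA; rewrite nhitE in zero.
rewrite [X in (_ - (X + _))%E]zero [X in (_ - (_ + X))%E](_ : _ =
    (rate A * expR (- rate A))%:E); last first.
  rewrite [LHS]one /poisson_prob -/(rate A); case: ifPn => [rA|].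
    rewrite esum_set1 /poisson_pmf ?rA ?expr1 ?fact0 ?invr1 ?mulr1//.
    by rewrite lee_fin mulr_ge0// expR_ge0.
  rewrite -leNgt => rA; have -> : rate A = 0 by apply/le_anti; rewrite rA rate_ge0.
  by rewrite mul0r diracE memNset.
rewrite -EFinD lee_fin.
have := expR_ge1Dx (- rate A); have := rate_ge0 A; move: (rate A) (expR _) => a b.
by move=> a0 ab; nra.
Qed.

(** The finite counts have the masses of a Poisson law, which add up to 1, so nothing is left for an
    infinite count. *)
Lemma ae_finite_points A : bounded_region A ->
  {ae P, forall w, finite_set [set j | A (X j w)]}.
Proof.
move=> [mA AD Afin]; have [_ /(_ A mA AD Afin) lawA _] := XP.
have mk k : measurable (count A @^-1` [set k%:R%:E]).
  by rewrite -[X in measurable X]setTI; exact: measurable_count.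
exists (~` \bigcup_k (count A @^-1` [set k%:R%:E])); split.
- by apply: measurableC; exact: bigcupT_measurable.
- rewrite probability_setC; last exact: bigcupT_measurable.
  rewrite measure_bigcup//; last first.
    apply/trivIsetP => i j _ _ ij; apply/seteqP; split=> // w [/= -> [/eqP]].
    by rewrite eqr_nat (negbTE ij).
  rewrite [X in (_ - X)%E](_ : _ = 1%E) ?subee//.
  rewrite (eq_eseriesr (fun k _ => lawA k)).
  rewrite -[RHS](_ : poisson_prob (rate A) 0 (\bigcup_k [set k]) = 1%E).
    rewrite measure_bigcup//; apply/trivIsetP => i j _ _ ij.
    by apply/seteqP; split=> // k [/= -> ij']; rewrite ij' eqxx in ij.
  rewrite (_ : \bigcup_k [set k] = setT); first exact: probability_setT.
  by apply/seteqP; split=> // k _; exists k.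
- move=> w /= nfin [k _ /= ck]; apply: nfin.
  exact: counting_finite ck.
Qed.

Lemma independent_counts n (A : 'I_n -> set E) (B : 'I_n -> set (\bar R)) :
  (forall v, bounded_region (A v)) ->
  (forall u v, u != v -> A u `&` A v = set0) ->
  (forall v, measurable (B v)) ->
  P (\bigcap_v (count (A v) @^-1` B v)) =
  (\prod_(v < n) P (count (A v) @^-1` B v))%E.
Proof.
move=> bA tA mB.
(* Independence is given for infinite sequences of regions, so the finite family is continued by
   empty regions. *)
pose ext T (F : 'I_n -> set T) (i : nat) : set T :=
  if insub i is Some v then F v else set0.
have extE T (F : 'I_n -> set T) (v : 'I_n) : ext T F v = F v.
  by rewrite /ext valK.
have [_ _ /(_ (ext _ A))] := XP; move=> h.
have {}h := h _ _ [fset i | i in iota 0 n]%fset _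
  (fun i => count (ext _ A i) @^-1` (ext _ B i)) _.
have jn i : i \in [fset i | i in iota 0 n]%fset = (i < n)%N.
  by rewrite !inE /= mem_iota.
transitivity (P (\bigcap_(i in [set` [fset i | i in iota 0 n]%fset])
    (count (ext _ A i) @^-1` ext _ B i))).
  congr (P _); apply/seteqP; split=> w h1.
    move=> i /=; rewrite jn => ni; have := h1 (Ordinal ni) I.
    by rewrite -(extE _ A) -(extE _ B).
  by move=> v _; have := h1 v; rewrite /= jn ltn_ord !extE; exact.
rewrite h//.
- rewrite (perm_big (iota 0 n)); last first.
    apply: uniq_perm; [exact: fset_uniq|exact: iota_uniq|move=> i].
    by rewrite [LHS]jn mem_iota.
  have -> : iota 0 n = index_iota 0 n by rewrite /index_iota subn0.
  rewrite big_mkord.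
  by apply: eq_bigr => v _; rewrite !extE.
- move=> i; rewrite /ext; case: insubP => [v _ _|_]; first exact: bA.
  by split=> //; rewrite measure0.
- apply/trivIsetP => i j _ _ ij; rewrite /ext.
  case: insubP => [u _ ui|_]; last by rewrite set0I.
  case: insubP => [v _ vj|_]; last by rewrite setI0.
  by apply: tA; apply: contraNneq ij => uv; rewrite -ui -vj uv.
- move=> i; rewrite jn => ni; exists (ext _ B i); last by rewrite setTI.
  by rewrite /ext; case: insubP.
Qed.

Lemma independent_counts2 A1 A2 B1 B2 :
  bounded_region A1 -> bounded_region A2 -> A1 `&` A2 = set0 ->
  measurable B1 -> measurable B2 ->
  P (count A1 @^-1` B1 `&` count A2 @^-1` B2) =
  (P (count A1 @^-1` B1) * P (count A2 @^-1` B2))%E.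
Proof.
move=> b1 b2 t mB1 mB2.
pose sel T (x y : T) (v : 'I_2) := if v == ord0 then x else y.
have := @independent_counts 2 (sel _ A1 A2) (sel _ B1 B2).
rewrite !big_ord_recl big_ord0 /= mule1 => <-.
- congr (P _); apply/seteqP; split=> w.
    by move=> [h1 h2] v _; rewrite /sel; case: ifP.
  by move=> h; split; [exact: (h ord0)|exact: (h ord_max)].
- by move=> v; rewrite /sel; case: ifP.
- by move=> -[[|[|//]] i] -[[|[|//]] j] //= _; rewrite /sel //= setIC.
- by move=> v; rewrite /sel; case: ifP.
Qed.

Lemma prob_hit_hit A1 A2 :
  bounded_region A1 -> bounded_region A2 -> A1 `&` A2 = set0 ->
  P [set w | hit A1 w /\ hit A2 w] =
  (P [set w | hit A1 w] * P [set w | hit A2 w])%E.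
Proof.
move=> b1 b2 t; rewrite (_ : [set w | hit A1 w /\ hit A2 w] =
  [set w | hit A1 w] `&` [set w | hit A2 w])// !hitE !preimage_setC.
by rewrite independent_counts2//; exact: measurableC.
Qed.

Lemma prob_hit_twice_hit A1 A2 :
  bounded_region A1 -> bounded_region A2 -> A1 `&` A2 = set0 ->
  P [set w | hit_twice A1 w /\ hit A2 w] =
  (P [set w | hit_twice A1 w] * P [set w | hit A2 w])%E.
Proof.
move=> b1 b2 t; rewrite (_ : [set w | hit_twice A1 w /\ hit A2 w] =
  [set w | hit_twice A1 w] `&` [set w | hit A2 w])//.
rewrite hit_twiceE hitE !preimage_setC independent_counts2//.
- rewrite (_ : [set x | _] = [set` `]1%E, +oo[ ] `|` [set +oo%E]).
    by apply: measurableU => //; exact: emeasurable_itv.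
  apply/seteqP; split=> x /=; rewrite in_itv/=.
    by case: x => [x|//|//] ->; rewrite ?ltry; [left|right].
  by case=> [/andP[]|->]; rewrite ?ltry.
- exact: measurableC.
Qed.

End poisson_points.

(** * The stretched graphon *)

(** Number of grid squares on which the empirical graphon is 1: a non-loop edge counts twice, a loop
    once. *)
Definition arcs (G : graph) : nat :=
  #|[pred u : 'I_(vertex_count G) * 'I_(vertex_count G) | adj u.1 u.2]|.

Definition loops (G : graph) : nat := #|[pred v : 'I_(vertex_count G) | adj v v]|.

Lemma loopsE (G : graph) : loops G = #|[pred u : 'I_(vertex_count G) *
  'I_(vertex_count G) | (u.1 == u.2) && adj u.1 u.2]|.
Proof.
have dinj : injective (fun v : 'I_(vertex_count G) => (v, v)) by move=> u v [].
rewrite /loops -(fintype.card_image dinj); apply: eq_card => -[u v].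
apply/fintype.imageP/idP => [[w + [-> ->]]|]; rewrite !inE /=.
  by move=> a; rewrite eqxx.
by move=> /andP[/eqP -> a]; exists v.
Qed.

(** The source of the different scalings: sampling is normalised by [2 * edges G], the stretched
    graphon by [arcs G]. *)
Lemma arcsE (G : graph) : arcs G = (2 * edges G + loops G)%N.
Proof.
pose up := [pred u : 'I_(vertex_count G) * 'I_(vertex_count G) |
  (u.1 < u.2)%N && adj u.1 u.2].
pose down := [pred u : 'I_(vertex_count G) * 'I_(vertex_count G) |
  (u.2 < u.1)%N && adj u.1 u.2].
pose diag := [pred u : 'I_(vertex_count G) * 'I_(vertex_count G) |
  (u.1 == u.2) && adj u.1 u.2].
have upE : edges G = #|up|.
  by apply: eq_card => u; apply/idP/idP; rewrite !inE.
pose swap (u : 'I_(vertex_count G) * 'I_(vertex_count G)) := (u.2, u.1).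
have swapK : involutive swap by case.
have downE : #|down| = #|up|.
  rewrite -(fintype.card_image (inv_inj swapK) up); apply: eq_card => u.
  apply/idP/fintype.imageP => [|[v + ->]]; rewrite !inE /= => /andP[uv a].
    by exists (swap u); rewrite ?swapK// inE /= uv adjC.
  by rewrite uv adjC.
rewrite upE mul2n -addnn -{2}downE loopsE -/diag /arcs -!sum1_card.
rewrite (bigID (fun u : 'I_(vertex_count G) * 'I_(vertex_count G) =>
  (u.1 < u.2)%N)) /= -addnA; congr addn.
  by apply: eq_bigl => u; rewrite !inE andbC.
rewrite (bigID (fun u : 'I_(vertex_count G) * 'I_(vertex_count G) => (u.2 < u.1)%N)) /=; congr addn.
  by apply: eq_bigl => u; rewrite !inE; case: ltngtP => _; rewrite ?andbF ?andbT.
by apply: eq_bigl => u; rewrite !inE -val_eqE; case: ltngtP => _; rewrite ?andbF ?andbT.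
Qed.

Section stretched.
Context {R : realType}.
Local Notation Lambda := (@lebesgue_measure R).
Local Notation Lambda2 := (Lambda \x Lambda)%E.
Local Notation RR := (measurableTypeR R).

Definition grid_cell (c : R) (i : nat) : set R := `[i%:R * c, i.+1%:R * c[%classic.

Lemma grid_cellE c i x : grid_cell c i x = (i%:R * c <= x < i.+1%:R * c) :> Prop.
Proof. by rewrite /grid_cell /= in_itv. Qed.

Lemma grid_cell_inj c i j x : grid_cell c i x -> grid_cell c j x -> i = j.
Proof.
rewrite !grid_cellE => /andP[ix xi] /andP[jx xj].
have c0 : 0 < c.
  by move: (le_lt_trans ix xi); rewrite -natr1 mulrDl mul1r ltrDl.
have := le_lt_trans ix xj; have := le_lt_trans jx xi.
rewrite !ltr_pM2r// !ltr_nat !ltnS => ji ij.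
by apply/eqP; rewrite eqn_leq ij.
Qed.

Lemma measurable_grid_cell c i : measurable (grid_cell c i : set RR).
Proof. exact: measurable_itv. Qed.

Lemma lebesgue_grid_cell c i : 0 <= c -> Lambda (grid_cell c i) = c%:E.
Proof.
move=> c0; rewrite /grid_cell lebesgue_measure_itv /= lte_fin.
rewrite -natr1 mulrDl mul1r ltrDl; case: ltP => [c1|c1].
  by rewrite -EFinB; congr (_%:E); rewrite addrAC subrr add0r.
by congr (_%:E); apply/le_anti; rewrite c0 c1.
Qed.

(** Common form of the empirical graphon, with [c] the inverse of the number of vertices, and of the
    stretched one, with [c] the inverse square root of [arcs G]. *)
Definition grid_arc (G : graph) (c : R) (x y : R) : bool :=
  `[< exists u v : 'I_(vertex_count G),
      [/\ adj u v, grid_cell c u x & grid_cell c v y] >].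

Lemma empirical_graphonE (G : graph) (x y : R) :
  empirical_graphon G x y = (grid_arc G (vertex_count G)%:R^-1 x y)%:R.
Proof.
congr (_%:R); congr nat_of_bool; apply/idP/asboolP.
  move=> /existsP[u /existsP[v /and3P[xu yv uv]]].
  by exists u, v; rewrite !grid_cellE.
move=> [u [v [uv]]]; rewrite !grid_cellE => xu yv.
by apply/existsP; exists u; apply/existsP; exists v; apply/and3P.
Qed.

(** Half-open cells are disjoint, so at most one term is nonzero. The sum form yields both the
    measurability and the integral. *)
Lemma grid_arcE (G : graph) (c : R) (z : R * R) : (grid_arc G c z.1 z.2)%:R =
  \sum_(u : 'I_(vertex_count G) * 'I_(vertex_count G) | adj u.1 u.2)
     \1_(grid_cell c u.1 `*` grid_cell c u.2) z :> R.
Proof.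
case: z => x y /=.
have ind i j : (x, y) \in grid_cell c i `*` grid_cell c j ->
    grid_cell c i x /\ grid_cell c j y.
  by move=> /set_mem.
rewrite /grid_arc; case: asboolP => [[u [v [uv xu yv]]]|no].
  rewrite (bigD1 (u, v)) //= indicE mem_set// big1 ?addr0// => -[u' v'] /andP[_].
  rewrite indicE; case: (boolP (_ \in _)) => // /ind[/= xu' yv'].
  by rewrite -(val_inj (grid_cell_inj xu xu')) -(val_inj (grid_cell_inj yv yv')) eqxx.
rewrite big1// => -[u v] /= uv; rewrite indicE; case: (boolP (_ \in _)) => // /ind[xu yv].
by exfalso; apply: no; exists u, v.
Qed.

Lemma measurable_grid_rect c i j :
  measurable (grid_cell c i `*` grid_cell c j : set (RR * RR)).
Proof. by apply: measurableX; exact: measurable_grid_cell. Qed.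

Lemma empirical_norm1E (G : graph) : (0 < vertex_count G)%N ->
  @empirical_norm1 R G = (arcs G)%:R * (vertex_count G)%:R ^- 2.
Proof.
move=> n0; set n := vertex_count G.
have n0' : 0 < n%:R :> R by rewrite ltr0n.
have nV0 : 0 <= n%:R^-1 :> R by rewrite invr_ge0 ltW.
have cellS (u : 'I_n) : grid_cell (n%:R^-1 : R) u `<=` `[0, 1].
  move=> x; rewrite grid_cellE /= in_itv/= => /andP[ux xu].
  rewrite (le_trans _ ux) ?mulr_ge0//= (le_trans (ltW xu))//.
  by rewrite ler_pdivrMr// mul1r ler_nat.
have mI : measurable (`[0%R, 1%R] `*` `[0%R, 1%R] : set (RR * RR)).
  by apply: measurableX; exact: measurable_itv.
rewrite /empirical_norm1 /Rintegral.
under eq_integral => z _.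
  rewrite empirical_graphonE ger0_norm// grid_arcE -sumEFin -big_filter.
over.
rewrite ge0_integral_sum//=; last first.
  move=> u; apply/measurable_EFinP/measurable_funTS/measurable_indic.
  exact: measurable_grid_rect.
rewrite (eq_bigr (fun=> (n%:R ^- 2)%:E)); last first.
  move=> u _; rewrite integral_indic//; last exact: measurable_grid_rect.
  rewrite setIidl; last by move=> z [/cellS ? /cellS].
  rewrite [LHS]product_measure1E; try exact: measurable_grid_cell.
  rewrite [X in (X * _)%E](lebesgue_grid_cell u.1 nV0).
  by rewrite [X in (_ * X)%E](lebesgue_grid_cell u.2 nV0) -EFinM -invfM.
by rewrite big_filter sumEFin /= sumr_const mulr_natl.
Qed.

(** The square root of the norm is s = 1 / (n c), so rescaling by s turns cells of length 1 / n into
    cells of length c. The truncation at 1 / s = n c removes nothing, because all cells of vertices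
    lie below it. *)
Lemma stretched_graphonE (G : graph) (x y : R) : (0 < arcs G)%N ->
  stretched_graphon G x y = (grid_arc G (Num.sqrt (arcs G)%:R)^-1 x y)%:R.
Proof.
move=> a0; set n := vertex_count G; set c := (Num.sqrt _)^-1.
have n0 : (0 < n)%N.
  by move: a0 => /card_gt0P[[u _] _]; exact: leq_ltn_trans (ltn_ord u).
have n0' : 0 < n%:R :> R by rewrite ltr0n.
have a0' : 0 < Num.sqrt (arcs G)%:R :> R by rewrite sqrtr_gt0 ltr0n.
have c0 : 0 < c by rewrite invr_gt0.
have sE : Num.sqrt (empirical_norm1 G) = n%:R^-1 * c^-1.
  rewrite empirical_norm1E// sqrtrM ?ler0n// -exprVn sqrtr_sqr ger0_norm.
    by rewrite mulrC invrK.
  by rewrite invr_ge0 ltW.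
rewrite /stretched_graphon sE; set s := n%:R^-1 * c^-1.
have s0 : 0 < s by rewrite mulr_gt0// invr_gt0.
have scale i z : grid_cell n%:R^-1 i (s * z) <-> grid_cell c i z.
  have cE j : j%:R * n%:R^-1 = s * (j%:R * c).
    by rewrite /s mulrCA -mulrA mulVf ?gt_eqF// mulr1.
  by rewrite !grid_cellE !cE ler_pM2l// ltr_pM2l.
have inside (u : 'I_n) z : grid_cell c u z -> 0 <= z < s^-1.
  rewrite grid_cellE => /andP[uz zu]; rewrite (le_trans _ uz)/=; last first.
    by rewrite mulr_ge0// ltW.
  apply: lt_le_trans zu _; rewrite /s invfM !invrK ler_pM2r// ler_nat.
  exact: ltn_ord.
rewrite empirical_graphonE; case: ifPn => [_|out].
  congr (_%:R); congr nat_of_bool; rewrite /grid_arc; congr asbool.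
  by apply/propext; split=> -[u [v [uv /scale xu /scale yv]]]; exists u, v.
rewrite /grid_arc; case: asboolP => // -[u [v [uv xu yv]]].
by move: out; rewrite (inside _ _ xu) (inside _ _ yv).
Qed.

Lemma measurable_stretched_graphon (G : graph) (D : set (RR * RR)) :
  (0 < arcs G)%N ->
  measurable_fun D (fun z => stretched_graphon G (z.1 : R) (z.2 : R)).
Proof.
move=> a0; apply: measurable_funTS.
rewrite (_ : (fun z => _) = (fun z : RR * RR =>
  \sum_(u <- [seq u <- index_enum ('I_(vertex_count G) * 'I_(vertex_count G))%type
            | adj u.1 u.2])
   \1_(grid_cell (Num.sqrt (arcs G)%:R)^-1 u.1 `*`
       grid_cell (Num.sqrt (arcs G)%:R)^-1 u.2) z)).
  apply: measurable_sum => u; apply: measurable_indic.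
  exact: measurable_grid_rect.
by apply/funext => z; rewrite stretched_graphonE// grid_arcE big_filter.
Qed.

End stretched.

(** * Null events of the sources *)

Section finite_probability.
Context {R : realType} {d : measure_display} {Omega : measurableType d}.
Variable P : probability Omega R.

Lemma expectation_finite (F : finType) (H : Omega -> F) (g : F -> R) :
  (forall x, measurable [set w | H w = x]) -> (forall x, 0 <= g x) ->
  (\int[P]_w (g (H w))%:E = \sum_x (g x)%:E * P [set w | H w = x])%E.
Proof.
move=> mH g0.
transitivity (\int[P]_w \sum_(x : F) ((g x)%:E * (\1_[set w | H w = x] w)%:E))%E.
  apply: eq_integral => w _; rewrite (bigD1 (H w))//= indicE mem_set// mule1.
  rewrite big1 ?adde0// => x /negPf xH; rewrite indicE memNset ?mule0//=.
  by move=> Hx; rewrite Hx eqxx in xH.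
rewrite ge0_integral_sum//=.
- apply: eq_bigr => x _; rewrite ge0_integralZl_EFin//.
    by rewrite integral_indic// setIT.
  by apply/measurable_EFinP; exact: measurable_indic.
- by move=> x; apply: measurable_funeM; apply/measurable_EFinP/measurable_indic.
- by move=> x w _; rewrite mule_ge0// lee_fin// indicE.
Qed.

Lemma measurable_finite_valued (F : finType) (H : Omega -> F) (A : set F) :
  (forall x, measurable [set w | H w = x]) -> measurable [set w | A (H w)].
Proof.
move=> mH; rewrite (_ : [set w | _] = [set w | exists x, H w = x /\ A x]).
  apply: measurable_exists => x; apply: measurable_conj => //.
  exact: measurable_cst_prop.
by apply/seteqP; split=> w /= => [?|[x [-> //]]]; exists (H w).
Qed.

Lemma prob_finite_valued (F : finType) (H : Omega -> F) (A : set F) :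
  (forall x, measurable [set w | H w = x]) ->
  (P [set w | A (H w)] = \sum_x P [set w | H w = x] * (\1_A x)%:E)%E.
Proof.
move=> mH; transitivity (\int[P]_w (\1_A (H w))%:E)%E.
  have mA := measurable_finite_valued A mH.
  transitivity (P ([set w | A (H w)] `&` setT)); first by rewrite setIT.
  rewrite -(integral_indic P measurableT mA).
  by apply: eq_integral => w _; rewrite !indicE.
rewrite expectation_finite//.
by apply: eq_bigr => x _; rewrite muleC.
Qed.

Lemma prob_exists_le (F : finType) (p : pred F) (A : F -> Omega -> Prop)
    (b : F -> R) :
  (forall u, measurable [set w | A u w]) ->
  (forall u, p u -> P [set w | A u w] <= (b u)%:E)%E ->
  (P [set w | exists u, p u /\ A u w] <= (\sum_(u | p u) b u)%:E)%E.
Proof.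
move=> mA Ab.
rewrite (_ : [set w | _] = [set w | exists2 u, u \in index_enum F & p u /\ A u w]).
  elim: (index_enum F) => [|u s ih].
    rewrite big_nil (_ : [set w | _] = set0) ?measure0//.
    by apply/seteqP; split=> w // [].
  have m1 : measurable [set w | p u /\ A u w].
    by apply: measurable_conj => //; exact: measurable_cst_prop.
  have ms : measurable [set w | exists2 u, u \in s & p u /\ A u w].
    rewrite (_ : [set w | _] = [set w | exists u, (u \in s /\ p u) /\ A u w]).
      apply: measurable_exists => v; apply: measurable_conj => //.
      exact: measurable_cst_prop.
    by apply/seteqP; split=> w /= => [[v ? []]|[v [[]]]]; exists v.
  rewrite (_ : [set w | _] = [set w | p u /\ A u w] `|`
      [set w | exists2 u, u \in s & p u /\ A u w]); last first.
    apply/seteqP; split=> w /=.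
      move=> [v]; rewrite inE => /orP[/eqP ->|vs]; first by left.
      by right; exists v.
    case=> [?|[v vs ?]]; first by exists u; rewrite ?mem_head.
    by exists v; rewrite // inE vs orbT.
  apply: le_trans (measureU2 _ _ _) _ => //.
  rewrite big_cons; case: ifPn => pu.
    rewrite EFinD; apply: leeD => //; apply: le_trans (Ab u pu).
    apply: le_measure; rewrite ?inE//; last by move=> w [].
    by move: m1; rewrite pu.
  rewrite [X in (X + _)%E](_ : _ = 0%E) ?add0e//.
  rewrite (_ : [set w | _ /\ A u w] = set0) ?measure0//.
  by apply/seteqP; split=> w // [].
apply/seteqP; split=> w /=; first by move=> [v h]; exists v; rewrite ?mem_index_enum.
by move=> [v _ h]; exists v.
Qed.

Lemma ae_prob0 (A : Omega -> Prop) : measurable [set w | A w] ->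
  (P [set w | A w] <= 0)%E -> {ae P, forall w, ~ A w}.
Proof.
move=> mA A0; exists [set w | A w]; split=> //; last by move=> w /= /contrapT.
by apply/eqP; rewrite eq_le A0 measure_ge0.
Qed.

Lemma ae_and (A B : Omega -> Prop) :
  {ae P, forall w, A w} -> {ae P, forall w, B w} ->
  {ae P, forall w, A w /\ B w}.
Proof. exact: filterI. Qed.

Lemma ae_forall_nat (A : nat -> Omega -> Prop) :
  (forall n, {ae P, forall w, A n w}) -> {ae P, forall w, forall n, A n w}.
Proof. by move=> /ae_foralln. Qed.

End finite_probability.

Section source_null_events.
Context {R : realType} {d : measure_display} {Omega : measurableType d}.
Variables (P : probability Omega R) (X : graphex_source P).
Local Notation RR := (measurableTypeR R).
Local Notation Lambda := (@lebesgue_measure R).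
Local Notation Rplus := (`[0%R, +oo[%classic : set R).

(** An atom appears as soon as the coin is at most the graphon, so a coin equal to 0 would join
    points where the stretched graphon is 0, and a coin above 1 would lose an edge where it is 1.
    The marks of stars and isolated edges must be positive for the same reason, their rates being
    0. *)
Lemma ae_coin i j : {ae P, forall w, 0 < coin X i j w <= 1}.
Proof.
have mC : measurable (~` `]0%R, 1%R] : set RR).
  by apply: measurableC; exact: measurable_itv.
apply: filterS (ae_prob0 (P := P) (A := fun w => (~` `]0%R, 1%R]) (coin X i j w)) _ _).
- by move=> w /contrapT; rewrite /= in_itv.
- by rewrite -[X in measurable X]setTI; exact: measurable_funP.
- have := coin_uniform X i j mC; rewrite /distribution /pushforward /= => ->.
  rewrite /uniform_prob integral_uniform_pdf.
  rewrite (_ : _ `&` _ = [set 0]) ?integral_set1//.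
  apply/seteqP; split=> x /=; last first.
    by move=> ->; rewrite !in_itv/= ltxx lexx ler01.
  rewrite !in_itv/= => -[nx /andP[x0 x1]]; apply/le_anti; rewrite x0 andbT leNgt.
  by apply/negP => x0'; apply: nx; rewrite x0' x1.
Qed.

Lemma ae_not_hit (d' : measure_display) (E : measurableType d')
    (mu : {measure set E -> \bar R}) (D : set E) (Y : nat -> {RV P >-> E})
    (A : set E) : poisson_process mu D Y -> measurable A -> A `<=` D ->
  mu A = 0%E -> {ae P, forall w, ~ hit Y A w}.
Proof.
move=> YP mA AD A0; apply: ae_prob0; first exact: measurable_hit.
by rewrite (le_trans (prob_hit_le YP _))// ?A0//; split; rewrite ?A0.
Qed.

Lemma ae_stars i : {ae P, forall w, forall k, 0 < (stars X i k w).2 :> R}.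
Proof.
have : {ae P, forall w, ~ hit (stars X i) (Rplus `*` [set 0] : set (RR * RR)) w}.
  apply: ae_not_hit (stars_poisson X i) _ _ _.
  - by apply: measurableX => //; exact: measurable_itv.
  - by move=> z [? /= ->]; split=> //=; rewrite in_itv/= lexx.
  - rewrite [LHS]product_measure1E//.
    by rewrite [X in (_ * X)%E]lebesgue_measure_set1 mule0.
apply: filterS => w nh k; have [/(_ k w)[/= k1 k2] _ _] := stars_poisson X i.
move: k2; rewrite in_itv/= andbT le_eqVlt => /orP[/eqP k0|//].
by exfalso; apply: nh; exists k; split.
Qed.

Lemma ae_isolated_edges : {ae P, forall w, forall k, 0 < (isolated_edges X k w).2 :> R}.
Proof.
have mD : measurable (Rplus `*` Rplus : set (RR * RR)).
  by apply: measurableX; exact: measurable_itv.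
have : {ae P, forall w, ~ hit (isolated_edges X)
    (Rplus `*` Rplus `*` [set 0] : set (RR * RR * RR)) w}.
  apply: ae_not_hit (isolated_edges_poisson X) _ _ _.
  - exact: measurableX.
  - by move=> z [? /= ->]; split=> //=; rewrite in_itv/= lexx.
  - rewrite [LHS]product_measure1E//.
    by rewrite [X in (_ * X)%E]lebesgue_measure_set1 mule0.
apply: filterS => w nh k.
have [/(_ k w)[/= k1 k2] _ _] := isolated_edges_poisson X.
move: k2; rewrite in_itv/= andbT le_eqVlt => /orP[/eqP k0|//].
by exfalso; apply: nh; exists k; split.
Qed.

Lemma rect_bounded (a b a' b' : bool) (x y x' y' : R) :
  0 <= x -> x <= y -> 0 <= x' -> x' <= y' ->
  bounded_region (Lambda \x Lambda)%E (Rplus `*` Rplus)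
    ([set` Interval (BSide a x) (BSide b y)] `*`
     [set` Interval (BSide a' x') (BSide b' y')] : set (RR * RR)) /\
  fine ((Lambda \x Lambda)%E
    ([set` Interval (BSide a x) (BSide b y)] `*`
     [set` Interval (BSide a' x') (BSide b' y')] : set (RR * RR))) =
  (y - x) * (y' - x').
Proof.
move=> x0 xy x'0 xy'.
have itvE (u v : R) (e f : bool) : u <= v ->
    Lambda [set` Interval (BSide e u) (BSide f v)] = (v - u)%:E.
  move=> uv; rewrite lebesgue_measure_itv /= lte_fin; case: ltP => [_|vu].
    by rewrite EFinB.
  by congr (_%:E); apply/eqP; rewrite eq_sym subr_eq0; apply/eqP/le_anti; rewrite uv vu.
have sub (u v : R) (e f : bool) : 0 <= u ->
    [set` Interval (BSide e u) (BSide f v)] `<=` Rplus.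
  move=> u0 z; rewrite /= !in_itv/= andbT => /andP[uz _].
  by apply: le_trans u0 _; case: e uz => //= /ltW.
have E : (Lambda \x Lambda)%E
    ([set` Interval (BSide a x) (BSide b y)] `*`
     [set` Interval (BSide a' x') (BSide b' y')] : set (RR * RR)) =
  ((y - x) * (y' - x'))%:E.
  rewrite [LHS]product_measure1E; try exact: measurable_itv.
  by rewrite [X in (X * _)%E]itvE// [X in (_ * X)%E]itvE// -EFinM.
split; last by rewrite E.
split.
- by apply: measurableX; exact: measurable_itv.
- by move=> z [z1 z2]; split; [exact: sub z1|exact: sub z2].
- by rewrite [X in (X < _)%E]E ltry.
Qed.

(** Two such points would be a single vertex of the process graph, possibly lying over two different
    cells. *)
Definition same_label (T M : R) (w : Omega) : Prop :=
  exists i j, i != j /\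
   [/\ (vertices X i w).1 <= T :> R, (vertices X i w).2 <= M :> R,
       (vertices X j w).2 <= M :> R & (vertices X i w).1 = (vertices X j w).1].

Lemma ae_distinct_labels (T M : R) : 0 <= T -> 0 <= M ->
  {ae P, forall w, ~ same_label T M w}.
Proof.
move=> T0 M0.
have m_pair (h : {RV P >-> (RR * RR)%type}) :
    measurable_fun setT (fun w => (h w).1) /\
    measurable_fun setT (fun w => (h w).2).
  by apply/measurable_fun_pairP; exact: measurable_funP.
have mlab : measurable [set w | same_label T M w].
  apply: measurable_exists => i; apply: measurable_exists => j.
  apply: measurable_conj; first exact: measurable_cst_prop.
  have [? ?] := m_pair (vertices X i); have [? ?] := m_pair (vertices X j).
  rewrite (_ : [set w | _] = [set w |
     ((vertices X i w).1 <= T :> R /\ (vertices X i w).2 <= M :> R) /\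
     ((vertices X j w).2 <= M :> R /\
     (vertices X i w).1 = (vertices X j w).1 :> R)]).
    apply: measurable_conj; apply: measurable_conj;
      by [exact: measurable_le_funs|exact: measurable_eq_funs].
  by apply/seteqP; split=> w /= => [[]|[[? ?] [? ?]]].
apply: ae_prob0 => //.
(* Cut [[0, T]] into [m + 1] strips: two points with the same label lie in a
   common strip, and a given strip contains two points with probability at
   most [(T M / (m + 1)) ^ 2]. *)
apply/lee_addgt0Pr => _/posnumP[e]; rewrite add0e.
have [m me] : exists m, (T * M) ^+ 2 / e%:num < m.+1%:R.
  exists (Num.truncn ((T * M) ^+ 2 / e%:num)).
  by rewrite truncnS_gt.
have m0 : 0 < m.+1%:R :> R by rewrite ltr0n.
pose strip (k : 'I_m.+1) : set (RR * RR) :=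
  `[k%:R * (T / m.+1%:R), k.+1%:R * (T / m.+1%:R)] `*` `[0, M].
have Tm : 0 <= T / m.+1%:R by rewrite divr_ge0// ltW.
have bstrip k : bounded_region (Lambda \x Lambda)%E (Rplus `*` Rplus) (strip k) /\
    fine ((Lambda \x Lambda)%E (strip k)) = T / m.+1%:R * M.
  have k1 : 0 <= k%:R * (T / m.+1%:R) by rewrite mulr_ge0.
  have k2 : k%:R * (T / m.+1%:R) <= k.+1%:R * (T / m.+1%:R).
    by rewrite ler_wpM2r// ler_nat.
  have [b ->] := rect_bounded true false true false k1 k2 (lexx 0) M0.
  by split=> //; rewrite subr0 -mulrBl -natrB// subSnn mul1r.
apply: (@le_trans _ _
    (P [set w | exists k : 'I_m.+1, true /\ hit_twice (vertices X) (strip k) w])).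
  apply: le_measure; rewrite ?inE//.
    apply: measurable_exists => k; apply: measurable_conj.
      exact: measurable_cst_prop.
    by apply: measurable_hit_twice; case: (bstrip k) => -[].
  move=> w [i [j [ij [iT iM jM sij]]]].
  have [/(_ i w)[/= i1 i2] _ _] := vertices_poisson X.
  have [/(_ j w)[/= j1 j2] _ _] := vertices_poisson X.
  move: i1 i2 j1 j2; rewrite !in_itv/= !andbT => i1 i2 j1 j2.
  set t : R := (vertices X i w).1 in iT i1 sij *.
  (* The index is the integer part of [t / (T / m.+1%:R)], except when [T = 0] or [t = T]; the
     strips are closed, so the last one contains [T]. *)
  have [k kt] : exists k : 'I_m.+1,
      k%:R * (T / m.+1%:R) <= t <= k.+1%:R * (T / m.+1%:R).
    have [T00|T00] := eqVneq T 0.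
      by exists ord0; move: iT; rewrite T00 !mul0r !mulr0 i1.
    have Tp : 0 < T by rewrite lt_neqAle eq_sym T00.
    have Tmp : 0 < T / m.+1%:R by rewrite divr_gt0.
    pose x := t / (T / m.+1%:R).
    have x0 : 0 <= x by rewrite divr_ge0.
    have xm : x <= m.+1%:R.
      by rewrite /x ler_pdivrMr// mulrCA divff ?gt_eqF// mulr1.
    have [tm|mt] := ltnP (Num.truncn x) m.+1.
      exists (Ordinal tm) => /=; rewrite -ler_pdivlMr// -/x truncn_le//=.
      by rewrite x0 /=; apply/ltW; rewrite -ltr_pdivrMr// -/x truncnS_gt.
    have xE : x = m.+1%:R.
      apply/le_anti; rewrite xm /=; apply: le_trans (_ : (Num.truncn x)%:R <= _).
        by rewrite ler_nat.
      by rewrite truncn_le.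
    exists ord_max => /=; apply/andP; split.
      by rewrite -ler_pdivlMr// -/x xE ler_nat.
    by rewrite -ler_pdivrMr// -/x xE ler_nat.
  exists k; split=> //; exists i, j; split=> //; split; split => /=; rewrite ?in_itv/= //.
  - by rewrite i2.
  - by rewrite -sij.
  - by rewrite j2.
apply: le_trans (@prob_exists_le _ _ _ P _ xpredT _ (fun=> (T / m.+1%:R * M) ^+ 2) _ _) _.
- by move=> k; apply: measurable_hit_twice; case: (bstrip k) => -[].
- move=> k _; have [bk <-] := bstrip k.
  by apply: (prob_hit_twice_le (vertices_poisson X)).
rewrite sumr_const card_ord lee_fin.
rewrite (_ : _ ^+ 2 *+ _ = (T * M) ^+ 2 / m.+1%:R).
  by rewrite ler_pdivrMr// [leRHS]mulrC -ler_pdivrMr// ltW.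
rewrite mulrAC expr_div_n -mulr_natr -mulrA; congr (_ * _).
by rewrite expr2 invfM -mulrA mulVf ?mulr1// gt_eqF.
Qed.

End source_null_events.

(** * Coupling sampling with the stretched graphon process *)

Section stretched_process.
Context {R : realType} {d : measure_display} {Omega : measurableType d}.
Variables (P : probability Omega R) (X : graphex_source P).
Local Notation RR := (measurableTypeR R).
Local Notation Lambda := (@lebesgue_measure R).
Local Notation Rplus := (`[0%R, +oo[%classic : set R).

Local Notation theta j w := ((vertices X j w).1 : R).
Local Notation vtheta j w := ((vertices X j w).2 : R).

Let theta_ge0 j w : 0 <= theta j w.
Proof. by case: (vertices_ge0 X j w). Qed.

Definition strip (c t : R) (v : nat) : set (RR * RR) := `[0, t] `*` grid_cell c v.

Definition late_strip (c r t : R) (v : nat) : set (RR * RR) :=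
  `]r, t] `*` grid_cell c v.

Lemma strip_bounded c t v : 0 <= c -> 0 <= t ->
  bounded_region (Lambda \x Lambda)%E (Rplus `*` Rplus) (strip c t v) /\
  fine ((Lambda \x Lambda)%E (strip c t v)) = t * c.
Proof.
move=> c0 t0; have v0 : 0 <= v%:R * c by rewrite mulr_ge0.
have v1 : v%:R * c <= v.+1%:R * c by rewrite ler_wpM2r// ler_nat.
have [b ->] := rect_bounded true false true true (lexx 0) t0 v0 v1.
by split=> //; rewrite subr0 -mulrBl -natrB// subSnn mul1r.
Qed.

Lemma late_strip_bounded c r t v : 0 <= c -> 0 <= r -> r <= t ->
  bounded_region (Lambda \x Lambda)%E (Rplus `*` Rplus) (late_strip c r t v) /\
  fine ((Lambda \x Lambda)%E (late_strip c r t v)) = (t - r) * c.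
Proof.
move=> c0 r0 rt; have v0 : 0 <= v%:R * c by rewrite mulr_ge0.
have v1 : v%:R * c <= v.+1%:R * c by rewrite ler_wpM2r// ler_nat.
have [b ->] := rect_bounded false false true true r0 rt v0 v1.
by split=> //; rewrite -mulrBl -natrB// subSnn mul1r.
Qed.

Lemma strip_disjoint (c : R) (A B : set R) (u v : nat) : u != v ->
  (A `*` grid_cell c u) `&` (B `*` grid_cell c v) = set0.
Proof.
move=> uv; apply/seteqP; split=> // z [[_ zu] [_ zv]].
by rewrite (grid_cell_inj zu zv) eqxx in uv.
Qed.

Lemma hit_stripP c t v w : hit (vertices X) (strip c t v) w <->
  exists j, theta j w <= t /\ grid_cell c v (vtheta j w).
Proof.
split=> [[j [/= jt jv]]|[j [jt jv]]]; exists j.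
  by move: jt; rewrite in_itv/= => /andP[].
by split=> //=; rewrite in_itv/= theta_ge0.
Qed.

Definition hits n (c t : R) (w : Omega) : {set 'I_n} :=
  [set v : 'I_n | `[< hit (vertices X) (strip c t v) w >]]%SET.

Lemma in_hits n c t w (v : 'I_n) :
  v \in hits n c t w <-> exists j, theta j w <= t /\ grid_cell c v (vtheta j w).
Proof. by rewrite inE -hit_stripP; split=> /asboolP. Qed.

Lemma measurable_hits n c t (T : {set 'I_n}) :
  measurable [set w | hits n c t w = T].
Proof.
rewrite (_ : [set w | _] = [set w | forall v : 'I_n,
    (`[< hit (vertices X) (strip c t v) w >] : bool) = (v \in T)]).
  apply: measurable_forall => v; apply: measurable_eqb.
  rewrite (_ : [set w | _] = [set w | hit (vertices X) (strip c t v) w]).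
    apply: measurable_hit; apply: measurableX; first exact: measurable_itv.
    exact: measurable_grid_cell.
  by apply/seteqP; split=> w /= /asboolP.
apply/seteqP; split=> w /= h; first by move=> v; rewrite -h inE.
by apply/setP => v; rewrite inE h.
Qed.

(** Strips over different cells are disjoint, so their counts are independent. The second factor is
    left unsimplified to match [1 - q] in [Smpl]. *)
Lemma prob_hits n c t (T : {set 'I_n}) : 0 <= c -> 0 <= t ->
  P [set w | hits n c t w = T] =
  (\prod_(v < n) (if v \in T then 1 - expR (- (t * c)) else
     1 - (1 - expR (- (t * c)))))%:E.
Proof.
move=> c0 t0.
have bs (v : 'I_n) := strip_bounded v c0 t0.
pose B (v : 'I_n) : set (\bar R) := if v \in T then ~` [set 0%E] else [set 0%E].
have E := independent_counts (vertices_poisson X)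
  (A := fun v : 'I_n => strip c t v) (B := B).
have -> : [set w | hits n c t w = T] = \bigcap_(v in [set: 'I_n])
    (point_count (vertices X) (strip c t v) @^-1` B v).
  apply/seteqP; split=> w /=.
    move=> HT v _; rewrite /B -HT inE; case: asboolP => h.
      by rewrite -preimage_setC -hitE.
    by rewrite -nhitE.
  move=> h; apply/setP => v; have := h v I; rewrite /B inE.
  case: ifP => vT; first by rewrite -preimage_setC -hitE => hv; apply/asboolP.
  by rewrite -nhitE => hv; apply/asboolP.
rewrite E.
- rewrite -prodEFin; apply: eq_bigr => v _; rewrite /B; case: (bs v) => bv qv.
  case: ifP => vT.
    by rewrite -preimage_setC -hitE (prob_hit (vertices_poisson X))// qv.
  by rewrite -nhitE (prob_nhit (vertices_poisson X))// qv opprB addrCA subrr addr0.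
- by move=> v; case: (bs v).
- by move=> u v uv; exact: strip_disjoint.
- by move=> v; rewrite /B; case: ifP => _ //; exact: measurableC.
Qed.

Lemma Smpl_hits (G : graph) c t : 0 <= c -> 0 <= t ->
  Smpl G (1 - expR (- (t * c))) =
  pushforward P (fun w => induced_ugraph (hits (vertex_count G) c t w)).
Proof.
move=> c0 t0; apply/funext => U; rewrite /Smpl /pushforward /=.
have -> : Num.min (1 - expR (- (t * c))) 1 = 1 - expR (- (t * c)).
  by apply/min_idPl; rewrite gerBl expR_ge0.
rewrite (prob_finite_valued P [set A | U (@induced_ugraph G A)]); last first.
  exact: measurable_hits.
apply: eq_bigr => A _; rewrite prob_hits//; congr (_ * _)%E.
Qed.

(** An almost sure event on which the process of the stretched graphon is determined by the
    positions of the points relative to the cells. *)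
Definition regular (r M : R) (w : Omega) : Prop :=
  [/\ forall i j, 0 < coin X i j w <= 1,
      forall j k, 0 < (stars X j k w).2 :> R,
      forall k, 0 < (isolated_edges X k w).2 :> R,
      finite_set [set j | theta j w <= r /\ vtheta j w <= M]
    & ~ same_label X r M w].

Lemma ae_regular r M : 0 <= r -> 0 <= M -> {ae P, forall w, regular r M w}.
Proof.
move=> r0 M0.
have h1 : {ae P, forall w, forall i j, 0 < coin X i j w <= 1}.
  by apply: ae_forall_nat => i; apply: ae_forall_nat => j; exact: ae_coin.
have h2 : {ae P, forall w, forall j k, 0 < (stars X j k w).2 :> R}.
  by apply: ae_forall_nat => j; exact: ae_stars.
have h3 := ae_isolated_edges X.
have [b _] := rect_bounded true false true false (lexx 0) r0 (lexx 0) M0.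
have h4 := ae_finite_points (vertices_poisson X) b.
have h5 := ae_distinct_labels X r0 M0.
have := ae_and h1 (ae_and h2 (ae_and h3 (ae_and h4 h5))).
apply: filterS => w [? [? [? [fin ?]]]]; split=> //.
apply: sub_finite_set fin => j [jr jM].
by have [? ?] := vertices_ge0 X j w; split=> /=; rewrite in_itv/=; apply/andP.
Qed.

Variable G : graph.
Hypothesis G0 : (0 < arcs G)%N.
Let c : R := (Num.sqrt (arcs G)%:R)^-1.
Let n := vertex_count G.
(** The right end of the last cell: points with a mark beyond [M] have no edge. *)
Let M : R := n%:R * c.
Let W := graphex_of_graphon (@stretched_graphon R G).

Let c0 : 0 <= c.
Proof. by rewrite invr_ge0 sqrtr_ge0. Qed.

Let cell_le (v : 'I_n) x : grid_cell c v x -> x <= M.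
Proof.
rewrite grid_cellE => /andP[_ /ltW xv]; apply: le_trans xv _.
by rewrite ler_wpM2r// ler_nat.
Qed.

(** The stretched graphon takes only the values 0 and 1, so the cells alone decide the comparison
    with a coin in ]0, 1]; positive marks exclude stars and isolated edges. *)
Lemma regular_process_adjP r t w a b : r <= t -> regular t M w ->
  process_adj X W r w a b <-> exists i j (u v : 'I_n),
   [/\ theta i w = a, theta j w = b, theta i w <= r, theta j w <= r &
    [/\ adj u v, grid_cell c u (vtheta i w) & grid_cell c v (vtheta j w)]].
Proof.
move=> rt [coin01 stars0 iso0 _ _]; rewrite process_adjP.
have atomP x y : process_atom X W w x y <-> exists i j (u v : 'I_n),
   [/\ theta i w = x, theta j w = y &
    [/\ adj u v, grid_cell c u (vtheta i w) & grid_cell c v (vtheta j w)]].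
  split=> [[[i [j [+ xi yj]]]|[[i [k [/=]]]|[k [/=]]]]|].
  - rewrite /= stretched_graphonE// /grid_arc; case: asboolP => [[u [v uv]] _|_].
      by exists i, j, u, v.
    by rewrite leNgt; case/andP: (coin01 i j) => ->.
  - by rewrite leNgt stars0.
  - by rewrite leNgt iso0.
  - move=> [i [j [u [v [xi yj uv]]]]]; left; exists i, j; split=> //=.
    rewrite stretched_graphonE// /grid_arc asboolT; last by exists u, v.
    by case/andP: (coin01 i j).
split=> [[/andP[_ ar] /andP[_ br] [/atomP|/atomP]] [i [j [u [v [ia jb [uv iu jv]]]]]]|].
- by exists i, j, u, v; rewrite ia jb; split.
- by exists j, i, v, u; rewrite ia jb; split=> //; split=> //; rewrite adjC.
- move=> [i [j [u [v [ia jb ir jr uv]]]]]; rewrite -ia -jb !theta_ge0 ir jr.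
  by split=> //; left; apply/atomP; exists i, j, u, v.
Qed.

Let label_inj t w i j (u v : 'I_n) : regular t M w -> theta i w <= t ->
  grid_cell c u (vtheta i w) -> grid_cell c v (vtheta j w) ->
  theta i w = theta j w -> i = j.
Proof.
move=> [_ _ _ _ nsl] it iu jv ij; apply/eqP/negPn/negP => nij; apply: nsl.
by exists i, j; split=> //; split=> //; [exact: cell_le iu|exact: cell_le jv].
Qed.

Let finite_process_vertices r t w : r <= t -> regular t M w ->
  finite_set (process_vertices X W r w).
Proof.
move=> rt reg; have [_ _ _ fin _] := reg.
apply: (@sub_finite_set _ _ ((fun j => theta j w) @`
    [set j | theta j w <= t /\ vtheta j w <= M])); last exact: finite_image.
move=> a [b /(regular_process_adjP _ _ rt reg)].
move=> [i [j [u [v [ia _ ir _ [_ iu _]]]]]]; exists i => //; split.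
  exact: le_trans rt.
exact: cell_le iu.
Qed.

(** Indexed by arcs: the second end is a hit neighbour that makes the first end visible, and is the
    same vertex for a loop. It is counted up to [t], which covers visibility both in the process at
    time [r] and in the sample. *)
Definition bad (r t : R) (w : Omega) : Prop :=
  exists e : 'I_n * 'I_n, adj e.1 e.2 /\
    ((hit_twice (vertices X) (strip c r e.1) w \/
      hit (vertices X) (late_strip c r t e.1) w) /\
     hit (vertices X) (strip c t e.2) w).

(** Distinct labels make each label belong to one point, hence to one cell, and [phi] returns the
    vertex of that cell. Two labels over one vertex would be a double hit before [r], which gives
    injectivity; a visible vertex of the sample without a point before [r] would have a late hit,
    which gives surjectivity. *)
Lemma process_ugraph_hits r t w : r <= t -> regular t M w -> ~ bad r t w ->
  process_ugraph X W r w = @induced_ugraph G (hits n c t w).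
Proof.
move=> rt reg nbad; have adjP := regular_process_adjP _ _ rt reg.
have finV := finite_process_vertices rt reg.
have early (u v : 'I_n) i : adj u v -> v \in hits n c t w -> theta i w <= t ->
    grid_cell c u (vtheta i w) -> theta i w <= r.
  move=> uv vt it iu; rewrite leNgt; apply/negP => ri; apply: nbad.
  exists (u, v); split=> //; split; last by apply/hit_stripP/in_hits.
  by right; exists i; split=> //=; rewrite in_itv/= ri it.
have single (u v : 'I_n) i j : adj u v -> v \in hits n c t w ->
    theta i w <= r -> theta j w <= r ->
    grid_cell c u (vtheta i w) -> grid_cell c u (vtheta j w) -> i = j.
  move=> uv vt ir jr iu ju; apply/eqP/negPn/negP => ij; apply: nbad.
  exists (u, v); split=> //; split; last by apply/hit_stripP/in_hits.
  by left; exists i, j; split=> //; split; split=> //=; rewrite in_itv/= theta_ge0.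
pose cell_of (a : R) (v : 'I_n) :=
  exists i, [/\ theta i w = a, theta i w <= r & grid_cell c v (vtheta i w)].
have cell_fun a u v : cell_of a u -> cell_of a v -> u = v.
  move=> [i [ia ir iu]] [j [ja _ jv]].
  have ij : i = j.
    by apply: (label_inj reg _ iu jv); [exact: le_trans rt|rewrite ia ja].
  by apply/val_inj/(grid_cell_inj iu); rewrite ij.
have n0 : (0 < n)%N.
  by move: G0 => /card_gt0P[[u _] _]; exact: leq_ltn_trans (ltn_ord u).
pose phi a : 'I_n := xget (Ordinal n0) (cell_of a).
have phiE a v : cell_of a v -> phi a = v.
  by move=> av; apply: (cell_fun a) => //; exact: (xgetI _ av).
have hitsr i (v : 'I_n) : theta i w <= r -> grid_cell c v (vtheta i w) ->
    v \in hits n c t w.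
  by move=> ir iv; apply/in_hits; exists i; split=> //; exact: le_trans rt.
have VP a : process_vertices X W r w a <-> exists u v b,
    [/\ cell_of a u, cell_of b v & adj u v].
  split=> [[b /adjP[i [j [u [v [ia jb ir jr [uv iu jv]]]]]]]|].
    by exists u, v, b; split=> //; [exists i|exists j].
  move=> [u [v [b [[i [ia ir iu]] [j [jb jr jv]] uv]]]].
  by exists b; apply/adjP; exists i, j, u, v; split.
apply/esym; apply: (unlabel_seq_graph_eq _ _ (phi := phi)).
- exact: fset_uniq.
- exact: enum_uniq.
- move=> a b; rewrite !in_fset_set// !inE => /VP[u [v [a' [au a'v uv]]]].
  move=> /VP[u' [v' [b' [bu' b'v' uv']]]]; rewrite (phiE _ _ au) (phiE _ _ bu') => uu'.
  move: au bu' a'v; rewrite -uu' => -[i [<- ir iu]] [j [<- jr ju]] [k [_ kr kv]].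
  by rewrite (single u v i j uv (hitsr _ _ kr kv) ir jr iu ju).
- move=> v; rewrite mem_enum inE; apply/idP/mapP.
    move=> /andP[vt /existsP[u /andP[ut vu]]].
    have [i [it iv]] := (in_hits _ _ _ _).1 vt.
    have [j [jt ju]] := (in_hits _ _ _ _).1 ut.
    have ir := early v u i vu ut it iv.
    have uv : adj u v by rewrite adjC.
    have jr := early u v j uv vt jt ju.
    have iv' : cell_of (theta i w) v by exists i.
    exists (theta i w); last by rewrite (phiE _ _ iv').
    rewrite in_fset_set// inE; apply/VP; exists v, u, (theta j w); split=> //.
    by exists j.
  move=> [a]; rewrite in_fset_set// inE => /VP[u [v' [b [au bv' uv]]]] ->.
  rewrite (phiE _ _ au); case: au bv' => i [_ ir iu] [j [_ jr jv]].
  rewrite (hitsr i)//=; apply/existsP; exists v'; rewrite uv andbT.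
  exact: (hitsr j).
- move=> a b; rewrite !in_fset_set// !inE => /VP[u [v [a' [au a'v uv]]]].
  move=> /VP[u' [v' [b' [bu' b'v' uv']]]]; rewrite (phiE _ _ au) (phiE _ _ bu').
  apply/idP/idP => [uu'|/adjP].
    case: au bu' => i [ia ir iu] [j [jb jr ju']].
    by apply/adjP; exists i, j, u, u'.
  move=> [i [j [x [y [ia jb ir jr [xy ix jy]]]]]].
  have ax : cell_of a x by exists i.
  have by' : cell_of b y by exists j.
  by rewrite (cell_fun _ _ _ au ax) (cell_fun _ _ _ bu' by').
Qed.

(** Each hit cell of a looped vertex provides a looped label, and distinct cells provide distinct
    labels. Only an inequality holds, since a cell hit several times yields several loops; it needs
    no exclusion of the bad event. *)
Lemma loop_count_process_ugraph r w : regular r M w ->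
  (#|hits n c r w :&: [set v | adj v v]| <= loop_count (process_ugraph X W r w))%N.
Proof.
move=> reg; have adjP := regular_process_adjP _ _ (lexx r) reg.
rewrite loop_count_seq_graph -size_filter.
pose label (v : 'I_n) : R :=
  if pselect (exists i, theta i w <= r /\ grid_cell c v (vtheta i w)) is left h
  then theta (sval (cid h)) w else 0.
have labelP (v : 'I_n) : v \in hits n c r w ->
    exists i, [/\ label v = theta i w, theta i w <= r & grid_cell c v (vtheta i w)].
  move=> /in_hits; rewrite /label; case: pselect => // h _.
  by case: cid => /= i [ir iv]; exists i.
set L := _ :&: _; rewrite cardE -(size_map label); apply: uniq_leq_size.
  rewrite map_inj_in_uniq ?enum_uniq// => u v.
  rewrite !mem_enum !inE => /andP[/asboolP ur _] /andP[/asboolP vr _] uv.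
  have [i [iu ir iuc]] : exists i, [/\ label u = theta i w, theta i w <= r
      & grid_cell c u (vtheta i w)] by apply: labelP; rewrite inE; apply/asboolP.
  have [j [jv jr jvc]] : exists i, [/\ label v = theta i w, theta i w <= r
      & grid_cell c v (vtheta i w)] by apply: labelP; rewrite inE; apply/asboolP.
  have ij : i = j by apply: (label_inj reg ir iuc jvc); rewrite -iu -jv.
  by apply/val_inj/(grid_cell_inj iuc); rewrite ij.
move=> _ /mapP[v + ->]; rewrite mem_enum inE => /andP[/labelP[i [-> ir iv]]].
rewrite inE => vv; rewrite mem_filter in_fset_set ?inE; last first.
  exact: finite_process_vertices (lexx r) reg.
have self : process_adj X W r w (theta i w) (theta i w).
  by apply/adjP; exists i, i, v, v.
by rewrite self /=; apply/mem_set; exists (theta i w).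
Qed.

End stretched_process.

(** * Expectations of coupled random graphs *)

Section coupling.
Context {R : realType} {d : measure_display} {Omega : measurableType d}.
Variable P : probability Omega R.

Lemma integrable_ugraph (Y : Omega -> ugraph) (f : ugraph -> R) (C : R) :
  measurable_fun setT Y -> (forall g, `|f g| <= C) ->
  P.-integrable setT (EFin \o (f \o Y)).
Proof.
move=> mY fC; apply: measurable_bounded_integrable => //.
- by rewrite [X in (X < _)%E]probability_setT ltry.
- by apply: (@measurableT_comp _ _ _ _ _ _ f).
- exists C; split; first by rewrite num_real.
  by move=> x Cx w _; apply: le_trans (fC _) (ltW Cx).
Qed.

Lemma integral_pushforward_ugraph (Y : Omega -> ugraph) (f : ugraph -> R) (C : R) :
  measurable_fun setT Y -> (forall g, `|f g| <= C) ->
  (\int[pushforward P Y]_g (f g)%:E = \int[P]_w (f (Y w))%:E)%E.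
Proof.
move=> mY fC; rewrite (integral_pushforward mY)//.
exact: integrable_ugraph fC.
Qed.

(** The difference of the integrands is at most [2 * C] on [B] and vanishes almost surely
    elsewhere. *)
Lemma coupling_integral (Y Z : Omega -> ugraph) (B : Omega -> Prop)
    (f : ugraph -> R) (C b : R) :
  measurable_fun setT Y -> measurable_fun setT Z -> (forall g, `|f g| <= C) ->
  measurable [set w | B w] -> {ae P, forall w, ~ B w -> Y w = Z w} ->
  (P [set w | B w] <= b%:E)%E ->
  (`|\int[P]_w (f (Y w))%:E - \int[P]_w (f (Z w))%:E| <= (2 * C * b)%:E)%E.
Proof.
move=> mY mZ fC mB YZ Bb.
have C0 : 0 <= C by exact: le_trans (fC (unlabel empty_graph)).
have iY := integrable_ugraph mY fC; have iZ := integrable_ugraph mZ fC.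
have mfY : measurable_fun setT (f \o Y) by apply: (@measurableT_comp _ _ _ _ _ _ f).
have mfZ : measurable_fun setT (f \o Z) by apply: (@measurableT_comp _ _ _ _ _ _ f).
rewrite -integralB_EFin//.
have mYZ : measurable_fun setT (fun w => ((f (Y w))%:E - (f (Z w))%:E)%E).
  by apply/measurable_EFinP; exact: measurable_funB.
apply: le_trans (le_abse_integral _ _ _) _ => //.
apply: (@le_trans _ _ (\int[P]_w ((2 * C)%:E * (\1_[set w | B w] w)%:E))%E).
  apply: ae_ge0_le_integral => //.
  - exact: measurableT_comp.
  - by move=> w _; rewrite mule_ge0// lee_fin ?mulr_ge0// indicE.
  - by apply: measurable_funeM; apply/measurable_EFinP; exact: measurable_indic.
  - apply: filterS YZ => w YZ _; rewrite -EFinB abse_EFin -EFinM lee_fin indicE.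
    have [Bw|nB] := pselect (B w).
      rewrite mem_set// mulr1 (le_trans (ler_normB _ _))//.
      by rewrite mulr_natl mulr2n lerD.
    by rewrite memNset// mulr0 YZ// subrr normr0.
rewrite ge0_integralZl_EFin//; last 2 first.
- by apply/measurable_EFinP; exact: measurable_indic.
- by rewrite mulr_ge0.
rewrite integral_indic// setIT [leRHS]EFinM; apply: lee_pmul => //.
- by rewrite lee_fin mulr_ge0.
Qed.

End coupling.

(** * Probability of the bad event *)

Section bad_event.
Context {R : realType} {d : measure_display} {Omega : measurableType d}.
Variables (P : probability Omega R) (X : graphex_source P) (G : graph).
Local Notation RR := (measurableTypeR R).
Let c : R := (Num.sqrt (arcs G)%:R)^-1.
Let n := vertex_count G.

Let c0 : 0 <= c.
Proof. by rewrite invr_ge0 sqrtr_ge0. Qed.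

Lemma measurable_bad r t : measurable [set w | bad X G r t w].
Proof.
have mS s v : measurable (strip c s v).
  by apply: measurableX; [exact: measurable_itv|exact: measurable_grid_cell].
have mL v : measurable (late_strip c r t v).
  by apply: measurableX; [exact: measurable_itv|exact: measurable_grid_cell].
apply: measurable_exists => e; apply: measurable_conj.
  exact: measurable_cst_prop.
apply: measurable_conj; last exact: measurable_hit.
by apply: measurable_disj; [exact: measurable_hit_twice|exact: measurable_hit].
Qed.

(** Union bound over arcs. The first factor bounds a double or late hit of one end. The hit of the
    other end is independent of it and contributes [1 - expR (- (t * c))], unless the arc is a
    loop. *)
Lemma prob_bad_le r t : 0 <= r -> r <= t ->
  (P [set w | bad X G r t w] <=
   (((r * c) ^+ 2 + (t - r) * c) *
    ((arcs G)%:R * (1 - expR (- (t * c))) + (loops G)%:R))%:E)%E.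
Proof.
move=> r0 rt; have t0 : 0 <= t by exact: le_trans rt.
set q := 1 - expR _; set K := (r * c) ^+ 2 + _.
have q0 : 0 <= q.
  by rewrite subr_ge0 -expR0 ler_expR oppr_le0 mulr_ge0.
have K0 : 0 <= K by rewrite addr_ge0// ?sqr_ge0// mulr_ge0// subr_ge0.
have mS s v : measurable (strip c s v).
  by apply: measurableX; [exact: measurable_itv|exact: measurable_grid_cell].
have mL v : measurable (late_strip c r t v).
  by apply: measurableX; [exact: measurable_itv|exact: measurable_grid_cell].
have m2 v : measurable [set w | hit_twice (vertices X) (strip c r v) w].
  exact: measurable_hit_twice.
have ml v : measurable [set w | hit (vertices X) (late_strip c r t v) w].
  exact: measurable_hit.
have mh v : measurable [set w | hit (vertices X) (strip c t v) w].
  exact: measurable_hit.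
have poi := vertices_poisson X.
(* For a loop the bound [K] is weakened to [K * q + K], so that the sum splits into one over all
   arcs and one over the loops. *)
pose b (e : 'I_n * 'I_n) : R := K * q + K * (e.1 == e.2)%:R.
apply: (@le_trans _ _ (\sum_(e : 'I_n * 'I_n | adj e.1 e.2) b e)%:E); last first.
  rewrite lee_fin big_split /= [leRHS]mulrDr; apply: lerD.
    by rewrite sumr_const -[leLHS]mulr_natr -mulrA ler_wpM2l// mulrC.
  rewrite -mulr_sumr ler_wpM2l// (eq_bigr (fun e => if e.1 == e.2 then 1 else 0)).
    rewrite -big_mkcondr /= -[1]/(1%:R) -natr_sum sum1_card loopsE.
    by rewrite ler_nat subset_leq_card//; apply/fintype.subsetP => e; rewrite !inE andbC.
  by move=> e _; case: ifP.
apply: prob_exists_le => [e|[u v] /= uv].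
  by apply: measurable_conj => //; exact: measurable_disj.
have [b2 e2] := strip_bounded u c0 r0.
have [bl el] := late_strip_bounded u c0 r0 rt.
have [bh eh] := strip_bounded v c0 t0.
have p2 := prob_hit_twice_le poi b2; rewrite e2 in p2.
have pl := prob_hit_le poi bl; rewrite el in pl.
have ph := prob_hit poi bh; rewrite eh -/q in ph.
rewrite /b /=; have [uv'|uv'] := eqVneq u v.
  rewrite mulr1; apply: (@le_trans _ _ (P ([set w | hit_twice (vertices X) (strip c r u) w]
      `|` [set w | hit (vertices X) (late_strip c r t u) w]))).
    apply: le_measure; rewrite ?inE//; last by move=> w [].
    by apply: measurable_conj => //; exact: measurable_disj.
    exact: measurableU.
  apply: le_trans (measureU2 _ _ _) _ => //.
  apply: (@le_trans _ _ K%:E); first by rewrite EFinD leeD.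
  by rewrite lee_fin lerDr mulr_ge0.
have P2 := prob_hit_twice_hit poi b2 bh (strip_disjoint _ _ _ uv').
have Pl := prob_hit_hit poi bl bh (strip_disjoint _ _ _ uv').
have mA := measurable_conj (m2 u) (mh v).
have mB := measurable_conj (ml u) (mh v).
apply: (@le_trans _ _ (P ([set w | hit_twice (vertices X) (strip c r u) w /\
                                   hit (vertices X) (strip c t v) w]
      `|` [set w | hit (vertices X) (late_strip c r t u) w /\
                   hit (vertices X) (strip c t v) w]))).
  apply: le_measure; rewrite ?inE//.
    by apply: measurable_conj => //; exact: measurable_disj.
    exact: measurableU.
  by move=> w [[? ?|? ?]]; [left|right].
apply: le_trans (measureU2 _ _ _) _ => //.
rewrite mulr0 addr0 /K mulrDl EFinD; apply: leeD.
  rewrite [leLHS]P2 EFinM [X in (_ * X)%E]ph.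
  by apply: lee_pmul => //; exact: measure_ge0.
rewrite [leLHS]Pl EFinM [X in (_ * X)%E]ph.
by apply: lee_pmul => //; exact: measure_ge0.
Qed.

End bad_event.

(** * Expectation of 2 to the minus number of loops *)

Section halving_hits.
Context {R : realType} {d : measure_display} {Omega : measurableType d}.
Variables (P : probability Omega R) (X : graphex_source P).

Lemma expectation_half_hits n (L : {set 'I_n}) (c t : R) : 0 <= c -> 0 <= t ->
  (\int[P]_w (2^-1 ^+ #|hits X n c t w :&: L|)%:E =
   ((1 - (1 - expR (- (t * c))) / 2) ^+ #|L|)%:E)%E.
Proof.
move=> c0 t0; set q := 1 - expR _.
have g0 (A : {set 'I_n}) : 0 <= 2^-1 ^+ #|A :&: L| :> R by rewrite exprn_ge0.
rewrite (expectation_finite P (measurable_hits X c t) g0).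
under eq_bigr => A _ do rewrite prob_hits// -/q -EFinM.
rewrite sumEFin; congr (_%:E).
(* Absorbs the power of 1 / 2 into the hit probabilities; the sum over all sets of hit cells is then
   the expansion of the product of the [a v + (1 - q)], which are [1 - q / 2] on [L] and 1
   elsewhere. *)
pose a (v : 'I_n) : R := if v \in L then q / 2 else q.
transitivity (\sum_(A : {set 'I_n}) \prod_v (if v \in A then a v else 1 - q)).
  apply: eq_bigr => A _; rewrite -prodr_const big_mkcond /= -big_split /=.
  apply: eq_bigr => v _; rewrite inE /a; case: (v \in A) => /=; last by rewrite mul1r.
  by case: (v \in L); rewrite ?mul1r// mulrC.
rewrite -(bigA_distr _ _ a (fun=> 1 - q)) -prodr_const [RHS]big_mkcond /=.
apply: eq_bigr => v _; rewrite /a; case: (v \in L); lra.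
Qed.

End halving_hits.

(** A loop keeps its vertex from being discarded as isolated. *)
Lemma loop_count_induced (G : graph) (A : {set 'I_(vertex_count G)}) :
  loop_count (induced_ugraph A) = #|A :&: [set v | adj v v]%SET|.
Proof.
rewrite loop_count_seq_graph cardE /enum_mem size_filter count_filter.
apply: eq_count => v; rewrite /= !inE; case vA : (v \in A) => /=; last by rewrite andbF.
apply: andb_idr => vv; apply/existsP; exists v.
by rewrite vA vv.
Qed.

(** * Estimates *)

Section estimates.
Context {R : realType}.
Implicit Types x y l r p K q : R.

(** The left side is ln (1 + p / (1 - p)), at most p / (1 - p); the last step amounts to p ^ 2 (1 -
    2 p) >= 0. *)
Lemma ln1B_ge p : 0 <= p -> p <= 2^-1 -> - ln (1 - p) <= p + 2 * p ^+ 2.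
Proof.
move=> p0 p12; have q0 : 0 < 1 - p by lra.
rewrite -lnV ?posrE//; have -> : (1 - p)^-1 = 1 + p / (1 - p).
  have : (1 - p) * (1 - p)^-1 = 1 by rewrite divff// gt_eqF.
  lra.
have pq : 0 <= p / (1 - p) by rewrite divr_ge0// ltW.
apply: le_trans (le_ln1Dx _) _; first lra.
rewrite ler_pdivrMr//; nra.
Qed.

Lemma ln1B_le p : p < 1 -> p <= - ln (1 - p).
Proof.
move=> p1; have := @le_ln1Dx R (- p); rewrite ltrNl opprK => /(_ p1); lra.
Qed.

(** The mismatch of the two scalings: the difference equals l / (x y (x + y)), and y >= x. *)
Lemma inv_diff_le x y l : 0 < x -> 0 < y -> 0 <= l -> y ^+ 2 = x ^+ 2 + l ->
  x^-1 - y^-1 <= l / x ^+ 3.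
Proof.
move=> x0 y0 l0 yx; have xy : x <= y by rewrite leNgt; apply/negP; nra.
rewrite ler_pdivlMr ?exprn_gt0//.
have x1 : x * x^-1 = 1 by rewrite divff ?gt_eqF.
have y1 : y * y^-1 = 1 by rewrite divff ?gt_eqF.
have -> : (x^-1 - y^-1) * x ^+ 3 = x ^+ 2 * (y - x) * y^-1.
  have -> : (x^-1 - y^-1) * x ^+ 3 = (x * x^-1) * x ^+ 2 - y^-1 * x ^+ 3 by lra.
  have -> : x ^+ 2 * (y - x) * y^-1 = (y * y^-1) * x ^+ 2 - y^-1 * x ^+ 3 by lra.
  by rewrite x1 y1.
rewrite ler_pdivrMr//; have -> : l = y ^+ 2 - x ^+ 2 by lra.
have : 0 <= (y - x) * (y * (y + x) - x ^+ 2) by apply: mulr_ge0; nra.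
lra.
Qed.

(** The bound of [prob_bad_le] in terms of x = sqrt (2 e) and y = sqrt (2 e + l). In the first
    factor, (r / y) ^ 2 gives r ^ 2 / x ^ 2, the logarithm exceeds r / x by at most 2 r ^ 2 / x ^ 2,
    and r / x exceeds r / y by at most r K / x ^ 2. In the second, the terms are at most x r, x K r
    and x K. *)
Lemma sampling_error x y l r K :
  1 <= x -> 0 < y -> 0 <= l -> l <= K * x -> 0 <= r -> r / x <= 2^-1 ->
  y ^+ 2 = x ^+ 2 + l ->
  ((r / y) ^+ 2 + (- ln (1 - r / x) - r / y)) * ((x ^+ 2 + l) * (r / x) + l) <=
  (3 * r ^+ 2 + r * K) * (r + K + K * r) / x.
Proof.
move=> x1 y0 l0 lK r0 p12 yx; have x0 : 0 < x by lra.
have K0 : 0 <= K by rewrite -(pmulr_lge0 _ x0); exact: le_trans lK.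
have xy : x <= y by rewrite leNgt; apply/negP; nra.
set p := r / x; have p0 : 0 <= p by rewrite divr_ge0// ltW.
have px : p * x = r by rewrite divfK ?gt_eqF.
have ry0 : 0 <= r / y by rewrite divr_ge0// ltW.
have ryp : r / y <= p by rewrite ler_wpM2l// lef_pV2.
have ry2 : (r / y) ^+ 2 <= p ^+ 2 by rewrite ler_pXn2r.
have ln_le := ln1B_ge p0 p12.
have x2 : 0 < x ^+ 2 by rewrite exprn_gt0.
have diff : p - r / y <= r * K / x ^+ 2.
  rewrite /p -mulrBr -mulrA ler_wpM2l//.
  apply: le_trans (inv_diff_le x0 y0 l0 yx) _.
  rewrite ler_pdivrMr ?exprn_gt0// (le_trans lK)// [x ^+ 3]exprSr.
  by rewrite mulrA divfK// gt_eqF.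
have p2 : p ^+ 2 = r ^+ 2 / x ^+ 2 by rewrite expr_div_n.
have A_le : (r / y) ^+ 2 + (- ln (1 - p) - r / y) <= (3 * r ^+ 2 + r * K) / x ^+ 2.
  rewrite mulrDl -mulrA -p2; lra.
have B_le : (x ^+ 2 + l) * p + l <= x * (r + K + K * r).
  have lp : l * p <= K * r.
    by have := ler_wpM2r p0 lK; rewrite -[K * x * p]mulrA [x * p]mulrC px.
  have xp : x ^+ 2 * p = x * r by rewrite -px; lra.
  have Krx : K * r <= x * (K * r) by rewrite ler_peMl// mulr_ge0.
  lra.
have B0 : 0 <= (x ^+ 2 + l) * p + l by rewrite addr_ge0// mulr_ge0// addr_ge0// ltW.
apply: le_trans (ler_wpM2r B0 A_le) _.
have A0 : 0 <= (3 * r ^+ 2 + r * K) / x ^+ 2.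
  by apply: divr_ge0; [rewrite addr_ge0 ?mulr_ge0 ?sqr_ge0|exact: ltW].
apply: le_trans (ler_wpM2l A0 B_le) _.
have x1' : x * x^-1 = 1 by rewrite divff ?gt_eqF.
rewrite -exprVn; set a := 3 * r ^+ 2 + _; set b := r + K + _; set z := x^-1.
have -> : a * z ^+ 2 * (x * b) = (x * z) * (a * b * z) by lra.
by rewrite x1' mul1r.
Qed.

(** Follows from 1 - q / 2 <= exp (- q / 2) by taking logarithms. *)
Lemma geometric_tight (delta q : R) (l : nat) : 0 < delta -> 0 <= q -> q <= 1 ->
  delta <= (1 - q / 2) ^+ l -> q * l%:R <= - 2 * ln delta.
Proof.
move=> d0 q0 q1 dq.
have : delta <= expR (- (q / 2) * l%:R).
  rewrite expRM_natr (le_trans dq)// lerXn2r ?nnegrE ?expR_ge0//; first lra.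
  exact: expR_ge1Dx.
have dE : delta = expR (ln delta) by rewrite lnK ?posrE.
rewrite {1}dE ler_expR; lra.
Qed.

(** Uses exp (- c) <= 1 / (1 + c) <= 1 - c / 2, the latter because (1 + c) (1 - c / 2) >= 1 on
    [0, 1]. *)
Lemma one_sub_expR_ge (c : R) : 0 <= c -> c <= 1 -> c / 2 <= 1 - expR (- c).
Proof.
move=> c0 c1; rewrite expRN; have e1 := @expR_ge1Dx R c.
have : (expR c)^-1 <= (1 + c)^-1 by rewrite lef_pV2 ?posrE ?expR_gt0//; lra.
have : (1 + c)^-1 <= 1 - c / 2; last lra.
have c1' : 0 < 1 + c by lra.
have : (1 + c) * (1 + c)^-1 = 1 by rewrite divff ?gt_eqF.
have : 0 < (1 + c)^-1 by rewrite invr_gt0.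
nra.
Qed.

(** The process controls l only through y, which itself contains l. Squaring gives l (l - K ^ 2) <=
    K ^ 2 x ^ 2, whereas l > (K ^ 2 + K) x with x >= 1 makes both l and l - K ^ 2 exceed K x. *)
Lemma quadratic_tight x y l K : 1 <= x -> 0 <= y -> 0 <= l -> 0 <= K ->
  y ^+ 2 = x ^+ 2 + l -> l <= K * y -> l <= (K ^+ 2 + K) * x.
Proof.
move=> x1 y0 l0 K0 yx ly; rewrite leNgt; apply/negP => lt.
have l2 : l ^+ 2 <= K ^+ 2 * (x ^+ 2 + l).
  by rewrite -yx -exprMn ler_pXn2r ?nnegrE ?mulr_ge0.
have h1 : K * x <= l - K ^+ 2 by nra.
have h2 : K * x < l by nra.
have h3 : 0 <= K * x by nra.
nra.
Qed.

End estimates.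

(** * Transfer of limits *)

Section convergence.
Context {R : realType}.

(** The real witnesses keep the difference of the extended values from being undefined. *)
Lemma ereal_cvg_close (a b : nat -> \bar R) (L : \bar R) (e : nat -> R) :
  (\forall j \near \oo, exists u v : R,
     [/\ a j = u%:E, b j = v%:E & `|u - v| <= e j]) ->
  e @ \oo --> 0 -> b @ \oo --> L -> a @ \oo --> L.
Proof.
move=> ab e0 bL.
have : (fun j => (a j - b j) + b j)%E @ \oo --> (0 + L)%E.
  apply: cvgeD => //.
  have e0' : (EFin \o e) @ \oo --> 0%E by apply: cvg_EFin => //; near=> j.
  have e0N : (EFin \o (\- e)) @ \oo --> 0%E.
    by apply: cvg_EFin; [near=> j|rewrite -oppr0; exact: cvgN].
  apply: (@squeeze_cvge _ _ _ _ (EFin \o (\- e)) _ (EFin \o e)) => //.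
  near=> j; have [u [v [-> -> uv]]] : exists u v : R,
     [/\ a j = u%:E, b j = v%:E & `|u - v| <= e j] by near: j.
  by rewrite -EFinB /= !lee_fin -ler_norml.
rewrite add0e; apply: cvg_trans; apply: near_eq_cvg; near=> j.
have [u [v [-> -> uv]]] : exists u v : R,
     [/\ a j = u%:E, b j = v%:E & `|u - v| <= e j] by near: j.
by rewrite -EFinB -EFinD subrK.
Unshelve. all: by end_near. Qed.

End convergence.

(** * Sampling against the stretched graphon process *)

Section comparison.
Context {R : realType} {d : measure_display} {Omega : measurableType d}.
Variables (P : probability Omega R) (X : graphex_source P).

Lemma continuous_ugraph (f : ugraph -> R) : continuous (f : ugraph -> R^o).
Proof. by move=> g A /nbhs_singleton Ag; apply: (principal_filterP g _).2. Qed.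

Lemma measurable_process_stretched (G : graph) (r : R) : (0 < arcs G)%N ->
  measurable_fun setT
    (process_ugraph X (graphex_of_graphon (@stretched_graphon R G)) r).
Proof.
move=> G0; apply: measurable_process_ugraph; first exact: measurable_cst.
exact: measurable_stretched_graphon.
Qed.

Lemma arcs_gt0 (G : graph) : (0 < edges G)%N -> (0 < arcs G)%N.
Proof. by move=> e0; rewrite arcsE ltn_addr// muln_gt0. Qed.

Lemma sqrt_arcs (G : graph) : Num.sqrt (arcs G)%:R ^+ 2 =
  Num.sqrt (2 * edges G)%:R ^+ 2 + (loops G)%:R :> R.
Proof. by rewrite !sqr_sqrtr ?ler0n// arcsE natrD. Qed.

Lemma measurable_induced_hits (G : graph) (c t : R) :
  measurable_fun setT (fun w => @induced_ugraph G (hits X (vertex_count G) c t w)).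
Proof.
move=> _ B _; rewrite setTI.
apply: (measurable_finite_valued (fun A => B (@induced_ugraph G A))).
exact: measurable_hits.
Qed.

(* The solution [t] of [1 - expR (- (t * c)) = p] for [c = 1 / sqrt (arcs G)]. *)
Definition hit_time (G : graph) (p : R) : R :=
  - ln (1 - p) * Num.sqrt (arcs G)%:R.

Lemma Smpl_hit_time (G : graph) (p : R) : (0 < arcs G)%N -> 0 <= p -> p < 1 ->
  let c := (Num.sqrt (arcs G)%:R)^-1 in
  [/\ 0 <= hit_time G p, 1 - expR (- (hit_time G p * c)) = p,
      hit_time G p * c = - ln (1 - p)
    & Smpl G p = pushforward P (fun w =>
        induced_ugraph (hits X (vertex_count G) c (hit_time G p) w))].
Proof.
move=> G0 p0 p1 c; have y0 : 0 < Num.sqrt (arcs G)%:R :> R by rewrite sqrtr_gt0 ltr0n.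
have t0 : 0 <= hit_time G p.
  by rewrite mulr_ge0// ?sqrtr_ge0// (le_trans p0)// ln1B_le.
have tc : hit_time G p * c = - ln (1 - p) by rewrite mulfK// gt_eqF.
have pE : 1 - expR (- (hit_time G p * c)) = p.
  by rewrite tc opprK lnK ?posrE ?subr_gt0// opprB addrCA subrr addr0.
split=> //; rewrite -{1}pE; apply: Smpl_hits => //.
by rewrite invr_ge0 ltW.
Qed.

(** The coupling made quantitative. The condition [r / x <= 2^-1] keeps the sampling probability
    away from 1, where the hit time explodes. *)
Lemma sampled_stretched_close (G : graph) (r K C : R) (f : ugraph -> R) :
  let x : R := Num.sqrt (2 * edges G)%:R in
  (0 < edges G)%N -> 0 <= r -> r / x <= 2^-1 -> (loops G)%:R <= K * x ->
  (forall g, `|f g| <= C) ->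
  exists u v : R,
    [/\ (\int[SmplD G r]_g (f g)%:E)%E = u%:E,
        (\int[GPD X (graphex_of_graphon (stretched_graphon G)) r]_g (f g)%:E)%E = v%:E
      & `|u - v| <= 2 * C * ((3 * r ^+ 2 + r * K) * (r + K + K * r)) * x^-1].
Proof.
move=> x e0 r0 p12 lK fC; have G0 := arcs_gt0 e0.
set p := r / x in p12.
have x1 : 1 <= x.
  by rewrite -sqrtr1 ler_wsqrtr// ler1n muln_gt0.
have x0 : 0 < x by exact: lt_le_trans x1.
have p0 : 0 <= p by rewrite divr_ge0// ltW.
have p1 : p < 1 by lra.
have [t0 pE tcE SE] := Smpl_hit_time G0 p0 p1.
set c := (Num.sqrt _)^-1 in pE tcE SE.
set t := hit_time G p in t0 pE tcE SE.
have y0 : 0 < Num.sqrt (arcs G)%:R :> R by rewrite sqrtr_gt0 ltr0n.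
have c0 : 0 < c by rewrite invr_gt0.
have l0 : 0 <= (loops G)%:R :> R by [].
have yx := sqrt_arcs G; rewrite -/x in yx.
have cx : c <= x^-1.
  by rewrite lef_pV2// leNgt; apply/negP; nra.
(* The hit time does not precede [r]: loops only shorten the cells, so r c <= r / x = p <= - ln (1 -
   p) = t c. *)
have rt : r <= t.
  rewrite -(ler_pM2r c0) tcE; apply: le_trans (ln1B_le p1).
  exact: ler_wpM2l.
have C0 : 0 <= C by exact: le_trans (fC (unlabel empty_graph)).
set Y := process_ugraph X (graphex_of_graphon (@stretched_graphon R G)) r.
set Z := fun w => _ in SE.
have mY : measurable_fun setT Y by exact: measurable_process_stretched.
have mZ : measurable_fun setT Z by exact: measurable_induced_hits.
have iY : (\int[P]_w (f (Y w))%:E)%E \is a fin_num.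
  exact: integrable_fin_num (integrable_ugraph P mY fC).
have iZ : (\int[P]_w (f (Z w))%:E)%E \is a fin_num.
  exact: integrable_fin_num (integrable_ugraph P mZ fC).
exists (fine (\int[P]_w (f (Z w))%:E)%E), (fine (\int[P]_w (f (Y w))%:E)%E).
rewrite !fineK//; split.
- by rewrite /SmplD -/p SE (integral_pushforward_ugraph P mZ fC).
- by rewrite /GPD (integral_pushforward_ugraph P mY fC).
have M0 : 0 <= (vertex_count G)%:R * c by rewrite mulr_ge0// ltW.
have YZ : {ae P, forall w, ~ bad X G r t w -> Y w = Z w}.
  apply: filterS (ae_regular X t0 M0) => w reg nbad.
  exact: process_ugraph_hits.
have := coupling_integral mY mZ fC (measurable_bad X G r t) YZ (prob_bad_le X G r0 rt).
rewrite -(fineK iY) -(fineK iZ) -EFinB abse_EFin lee_fin distrC => /le_trans; apply.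
rewrite -[leRHS]mulrA ler_wpM2l ?mulr_ge0//.
have := sampling_error x1 y0 l0 lK r0 p12 yx.
have arcsR : (arcs G)%:R = x ^+ 2 + (loops G)%:R by rewrite -yx sqr_sqrtr.
by rewrite -/p -/c pE mulrBl tcE arcsR.
Qed.

Definition half_loops (g : ugraph) : R := 2^-1 ^+ loop_count g.

Lemma half_loops_bounded g : `|half_loops g| <= 1.
Proof. by rewrite ger0_norm ?exprn_ge0// exprn_ile1// invf_le1// ler1n. Qed.

Lemma sampled_half_loops (G : graph) :
  let x : R := Num.sqrt (2 * edges G)%:R in (0 < edges G)%N ->
  (\int[SmplD G 1]_g (half_loops g)%:E)%E = ((1 - x^-1 / 2) ^+ loops G)%:E.
Proof.
move=> x e0; have G0 := arcs_gt0 e0.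
(* Strict, because the hit time is used at the probability 1 / x, which must be below 1; here 2 e is
   at least 2. *)
have x1 : 1 < x by rewrite -sqrtr1 ltr_sqrt ?ltr0n ?muln_gt0// ltr1n (leq_pmulr 2).
have p0 : 0 <= x^-1 by rewrite invr_ge0 ltW// (lt_trans _ x1).
have p1 : x^-1 < 1 by rewrite invf_lt1// (lt_trans _ x1).
have [t0 pE tcE SE] := Smpl_hit_time G0 p0 p1.
rewrite /SmplD mul1r -/x SE.
rewrite (integral_pushforward_ugraph P (measurable_induced_hits _ _ _) half_loops_bounded).
under eq_integral => w _ do rewrite /half_loops loop_count_induced.
by rewrite expectation_half_hits ?pE ?cardsE// invr_ge0 sqrtr_ge0.
Qed.

(** An upper bound suffices, so there is no coupling error: the loops of the process are at least as
    many as the looped cells hit before time 1, whose law is known exactly. *)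
Lemma stretched_half_loops_le (G : graph) : (0 < arcs G)%N ->
  (\int[GPD X (graphex_of_graphon (stretched_graphon G)) 1]_g (half_loops g)%:E
   <= ((1 - (1 - expR (- (Num.sqrt (arcs G)%:R)^-1)) / 2) ^+ loops G)%:E)%E.
Proof.
move=> G0; set c := (Num.sqrt _)^-1; set q := 1 - expR _.
have c0 : 0 <= c by rewrite invr_ge0 sqrtr_ge0.
have M0 : 0 <= (vertex_count G)%:R * c by rewrite mulr_ge0.
have mY := measurable_process_stretched 1 G0.
rewrite /GPD (integral_pushforward_ugraph P mY half_loops_bounded).
have := expectation_half_hits X [set v : 'I_(vertex_count G) | adj v v]%SET c0 ler01.
rewrite mul1r cardsE -/q => <-.
apply: ae_ge0_le_integral => //.
- by move=> w _; rewrite lee_fin exprn_ge0.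
- apply/measurable_EFinP; apply: (@measurableT_comp _ _ _ _ _ _ half_loops) => //.
- apply/measurable_EFinP => _ B _; rewrite setTI.
  apply: (measurable_finite_valued (H := hits X (vertex_count G) c 1)
    (fun A => B (2^-1 ^+ #|A :&: [set v | adj v v]%SET|))).
  exact: measurable_hits.
- apply: filterS (ae_regular X ler01 M0) => w reg _.
  rewrite lee_fin ler_wiXn2l ?invr_ge0 ?invf_le1 ?ler1n//.
  exact: loop_count_process_ugraph.
Qed.

(** The integrand is positive everywhere, so a zero integral would make the whole probability space
    a null set. *)
Lemma expectation_half_loops_gt0 (Y : Omega -> ugraph) : measurable_fun setT Y ->
  (0 < \int[P]_w (half_loops (Y w))%:E)%E.
Proof.
move=> mY; rewrite lt0e; apply/andP; split; last first.
  by apply: integral_ge0 => w _; rewrite lee_fin exprn_ge0.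
have mf : measurable_fun setT (fun w => (half_loops (Y w))%:E).
  by apply/measurable_EFinP; apply: (@measurableT_comp _ _ _ _ _ _ half_loops).
apply/eqP => I0; have := (ae_eq_integral_abs P measurableT mf).1.
rewrite (eq_integral (fun w => (half_loops (Y w))%:E)); last first.
  by move=> w _; rewrite gee0_abs// lee_fin exprn_ge0.
move=> /(_ I0) [N [mN N0 sN]].
have NT : N = setT.
  apply/seteqP; split=> // w _; apply: sN => /= /(_ I) /eqP.
  by rewrite eqe expf_eq0 invr_eq0 pnatr_eq0 andbF.
by move: N0; rewrite NT [LHS]probability_setT => /eqP; rewrite onee_eq0.
Qed.

(** A real [delta] strictly between 0 and [L] is eventually a lower bound of [a], which turns the
    geometric upper bound into a bound on [q j * l j]. *)
Lemma geometric_limit_tight (a : nat -> \bar R) (q : nat -> R) (l : nat -> nat)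
    (L : \bar R) : (0 < L)%E -> a @ \oo --> L ->
  (\forall j \near \oo, [/\ 0 <= q j, q j <= 1 & (a j <= ((1 - q j / 2) ^+ l j)%:E)%E]) ->
  exists2 K, 0 <= K & \forall j \near \oo, q j * (l j)%:R <= K.
Proof.
move=> L0 aL alq.
have [delta d0 dL] : exists2 delta : R, 0 < delta & (delta%:E < L)%E.
  case: L L0 {aL} => [s|_|//]; last by exists 1; rewrite ?ltry.
  by rewrite lte_fin => s0; exists (s / 2); rewrite ?lte_fin; lra.
have daL : \forall j \near \oo, (delta%:E < a j)%E.
  apply: (aL [set z | (delta%:E < z)%E]); apply: open_nbhs_nbhs; split=> //.
  exact: open_ereal_gt_ereal.
exists `|- 2 * ln delta| => //; near=> j.
have [q0 q1 aj] : [/\ 0 <= q j, q j <= 1 & (a j <= ((1 - q j / 2) ^+ l j)%:E)%E].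
  by near: j.
apply: le_trans (ler_norm _); apply: geometric_tight => //.
rewrite -lee_fin; apply: le_trans aj; apply: ltW; near: j.
exact: daL.
Unshelve. all: by end_near. Qed.

Lemma near_sqrt_edges (G : nat -> graph) (M : R) : edges (G j) @[j --> \oo] --> \oo ->
  \forall j \near \oo, (0 < edges (G j))%N /\ M <= Num.sqrt (2 * edges (G j))%:R.
Proof.
move=> eG; have : \forall j \near \oo, ((Num.truncn (M ^+ 2)).+1 <= edges (G j))%N.
  by apply: (eG [set m | ((Num.truncn (M ^+ 2)).+1 <= m)%N]); exact: nbhs_infty_ge.
apply: filterS => j ej; split; first exact: leq_ltn_trans ej.
have [M0|M0] := leP M 0; first by rewrite (le_trans M0)// sqrtr_ge0.
rewrite -[M]ger0_norm ?(ltW M0)// -sqrtr_sqr ler_wsqrtr//.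
apply: le_trans (ltW (truncnS_gt _)) _.
by rewrite ler_nat (leq_trans ej)// leq_pmull.
Qed.

Lemma cvg_inv_sqrt_edges (G : nat -> graph) : edges (G j) @[j --> \oo] --> \oo ->
  ((Num.sqrt (2 * edges (G j))%:R)^-1 : R) @[j --> \oo] --> (0 : R).
Proof.
move=> eG; apply/cvgrPdist_le => _/posnumP[e].
have := near_sqrt_edges (e%:num^-1) eG; apply: filterS => j [e0 ej].
rewrite sub0r normrN ger0_norm ?invr_ge0 ?sqrtr_ge0//.
by rewrite -[leRHS]invrK lef_pV2 ?posrE ?invr_gt0// (lt_le_trans _ ej)// invr_gt0.
Qed.

End comparison.

Theorem lemma5p4 (R : realType) (d : measure_display)
    (Omega : measurableType d) (P : probability Omega R)
    (X : graphex_source P) (G : nat -> graph) (W : @graphex R) :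
  is_graphex W ->
  edges (G j) @[j --> \oo] --> \oo ->
  (forall r : R, 0 <= r ->
     weakly_converges (fun j => SmplD (G j) r) (GPD X W r)) <->
  (forall r : R, 0 <= r ->
     weakly_converges
       (fun j => GPD X (graphex_of_graphon (stretched_graphon (G j))) r)
       (GPD X W r)).
Proof.
move=> HW eG.
have mW r : measurable_fun setT (process_ugraph X W r).
  apply: measurable_process_ugraph.
  - exact: star_rate_measurable HW.
  - exact: graphon_measurable HW.
pose x j : R := Num.sqrt (2 * edges (G j))%:R.
pose y j : R := Num.sqrt (arcs (G j))%:R.
(* The limit law is the same in both conditions, so this positivity serves both implications. *)
have half_gt0 : (0 < \int[GPD X W 1]_g (half_loops g)%:E)%E.
  rewrite /GPD (integral_pushforward_ugraph P (mW 1) (@half_loops_bounded R)).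
  exact: expectation_half_loops_gt0.
have bounded_half : bounded_fun (half_loops : ugraph -> R).
  exists 1; split; first exact: num_real.
  by move=> z /ltW z1 g _; apply: le_trans (half_loops_bounded _) _.
(* Symmetric in the two laws: once the loops are O (x), either convergence carries over to the
   other, and each implication has only to bound the loops. *)
have close K : 0 <= K -> (\forall j \near \oo, (loops (G j))%:R <= K * x j) ->
  forall r (f : ugraph -> R), 0 <= r -> bounded_fun f ->
  exists e : nat -> R, e @ \oo --> 0 /\
  \forall j \near \oo, exists u v : R,
   [/\ (\int[SmplD (G j) r]_g (f g)%:E)%E = u%:E,
       (\int[GPD X (graphex_of_graphon (stretched_graphon (G j))) r]_g (f g)%:E)%E = v%:E
     & `|u - v| <= e j].
  move=> K0 lK r f r0 [M0 [M0real fM]].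
  have fC g : `|f g| <= M0 + 1 by apply: (fM (M0 + 1)) => //; rewrite ltrDl.
  exists (fun j => 2 * (M0 + 1) * ((3 * r ^+ 2 + r * K) * (r + K + K * r)) * (x j)^-1).
  split.
    rewrite -(mulr0 (2 * (M0 + 1) * ((3 * r ^+ 2 + r * K) * (r + K + K * r)))).
    by apply: cvgM; [exact: cvg_cst|exact: cvg_inv_sqrt_edges].
  (* The threshold makes [x j] positive and [r / x j] at most 1 / 2. *)
  have := near_sqrt_edges (2 * r + 1) eG.
  apply: filterS2 lK => j lKj [e0 xj].
  apply: sampled_stretched_close => //.
  by rewrite ler_pdivrMr -/(x j); [rewrite /x; lra|rewrite /x; lra].
split=> conv.
- have [K K0 lK] : exists2 K, 0 <= K & \forall j \near \oo, (x j)^-1 * (loops (G j))%:R <= K.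
    have half := conv 1 ler01 _ (@continuous_ugraph R (@half_loops R)) bounded_half.
    apply: (geometric_limit_tight (l := fun j => loops (G j))
      (q := fun j => (x j)^-1) half_gt0 half).
    have := near_sqrt_edges (1 : R) eG; apply: filterS => j [e0 x1].
    rewrite (sampled_half_loops X e0); split=> //.
      by rewrite invr_ge0 sqrtr_ge0.
    by rewrite invf_le1// (lt_le_trans _ x1).
  move=> r r0 f cf bf.
  have lK' : \forall j \near \oo, (loops (G j))%:R <= K * x j.
    have := near_sqrt_edges (1 : R) eG; apply: filterS2 lK => j lKj [e0 x1].
    by rewrite -ler_pdivrMr ?(lt_le_trans _ x1)// mulrC.
  have [e [e0 uv]] := close K K0 lK' r f r0 bf.
  have vu : \forall j \near \oo, exists v u : R,
   [/\ (\int[GPD X (graphex_of_graphon (stretched_graphon (G j))) r]_g (f g)%:E)%E = v%:E,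
       (\int[SmplD (G j) r]_g (f g)%:E)%E = u%:E & `|v - u| <= e j].
    by apply: filterS uv => j [u [v [uE vE uv]]]; exists v, u; rewrite distrC.
  exact: (@ereal_cvg_close R _ _ _ e vu e0 (conv r r0 f cf bf)).
- have [K K0 lK] : exists2 K, 0 <= K & \forall j \near \oo,
      (1 - expR (- (y j)^-1)) * (loops (G j))%:R <= K.
    have half := conv 1 ler01 _ (@continuous_ugraph R (@half_loops R)) bounded_half.
    apply: (geometric_limit_tight (l := fun j => loops (G j))
      (q := fun j => 1 - expR (- (y j)^-1)) half_gt0 half).
    have := near_sqrt_edges (1 : R) eG; apply: filterS => j [e0 x1].
    split; last exact: stretched_half_loops_le (arcs_gt0 e0).
      by rewrite subr_ge0 -expR0 ler_expR oppr_le0 invr_ge0 sqrtr_ge0.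
    by rewrite gerBl expR_ge0.
  (* Since 1 - exp (- 1 / y) >= 1 / (2 y), the bound just obtained gives l <= 2 K y, and
     [quadratic_tight] with constant [2 * K] replaces y by x. *)
  have lK' : \forall j \near \oo, (loops (G j))%:R <= ((2 * K) ^+ 2 + 2 * K) * x j.
    have := near_sqrt_edges (1 : R) eG; apply: filterS2 lK => j lKj [e0 x1].
    have yx := sqrt_arcs (R := R) (G j); rewrite -/(x j) -/(y j) in yx.
    have l0 : 0 <= (loops (G j))%:R :> R by [].
    have y0 : 0 <= y j by exact: sqrtr_ge0.
    have y1 : 1 <= y j by rewrite leNgt; apply/negP; rewrite /x in yx; nra.
    apply: quadratic_tight yx _ => //; first by rewrite mulr_ge0.
    have yV0 : 0 <= (y j)^-1 by rewrite invr_ge0.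
    have yV1 : (y j)^-1 <= 1 by rewrite invf_le1// (lt_le_trans _ y1).
    have := ler_wpM2r l0 (one_sub_expR_ge yV0 yV1) => /le_trans/(_ lKj).
    rewrite -(ler_pM2l (x := 2 * y j)) ?mulr_gt0 ?(lt_le_trans _ y1)//.
    have -> : 2 * y j * ((y j)^-1 / 2 * (loops (G j))%:R) =
        (y j * (y j)^-1) * (loops (G j))%:R by lra.
    by rewrite divff ?gt_eqF ?(lt_le_trans _ y1)// mul1r mulrAC.
  have K'0 : 0 <= (2 * K) ^+ 2 + 2 * K by rewrite addr_ge0 ?sqr_ge0 ?mulr_ge0.
  move=> r r0 f cf bf; have [e [e0 uv]] := close _ K'0 lK' r f r0 bf.
  exact: (@ereal_cvg_close R _ _ _ e uv e0 (conv r r0 f cf bf)).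
Qed.
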